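(* For every $\eta>0$ there exists $\varepsilon_0>0$ such that for every $0<\varepsilon\le\varepsilon_0$ there exists $n_0$ such that the following holds for all $n\ge n_0$: if $H$ is a $5$-graph on $n$ vertices with $$\delta_2(H)\ge\left(\frac{91}{216}+\eta\right)\binom{n}{3},$$ then $H$ contains a $Y_{5,4}$-tiling covering all but at most $\varepsilon n$ vertices. In particular, $t(5,2,2)=\frac{91}{216}$.
   Context: A $k$-graph $H=(V,E)$ ($k\ge 2$) has a vertex set $V$ and an edge set $E\subseteq\binom{V}{k}$. For $S\in\binom{V}{d}$, $\deg_H(S)$ is the number of $T\in\binom{V}{k-d}$ with $S\cup T\in E$, and the minimum $d$-degree $\delta_d(H)$ is the minimum of $\deg_H(S)$ over all $S\in\binom{V}{d}$. For $k>b\ge 0$, $Y_{k,b}$ is the $k$-graph consisting of two edges that intersect in exactly $b$ vertices. For $k$-graphs $F$ and $H$, an $F$-tiling in $H$ is a subgraph of $H$ consisting of vertex-disjoint copies of $F$. For $k\ge 3$, $1\le\ell<k/2$, $1\le d\le k-1$ and $\varepsilon>0$, $t_d^\ell(k,n,\varepsilon)$ denotes the minimum $t$ such that every $k$-graph $H$ on $n$ vertices with $\delta_d(H)\ge t$ contains a $Y_{k,2\ell}$-tiling covering all but at most $\varepsilon n$ vertices of $H$, and $$t(k,d,\ell):=\limsup_{\varepsilon\to 0}\,\limsup_{n\to\infty}\frac{t_d^\ell(k,n,\varepsilon)}{\binom{n}{k-d}}.$$ *)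

(* Defs.v *)
From mathcomp Require Import all_boot all_order all_algebra.
From mathcomp Require Import boolp reals ereal topology normedtype sequences.
Set Implicit Arguments.
Unset Strict Implicit.
Unset Printing Implicit Defensive.
Import Order.TTheory GRing.Theory Num.Theory.
Import numFieldNormedType.Exports.

Record kgraph (k : nat) := KGraph {
  vertex :> finType;
  edge : {set {set vertex}};
  card_edge : forall e, e \in edge -> #|e| = k
}.

Definition degree (k : nat) (H : kgraph k) (S : {set H}) : nat :=
  #|[set T : {set H} | (#|T| == k - #|S|) && (S :|: T \in edge H)]|.

(* 'C(#|H|, k - d) bounds every degree of a d-set, so that as the unit of the
   iterated minimum it only matters when H has no d-set at all. *)
Definition min_degree (k d : nat) (H : kgraph k) : nat :=
  \big[minn/'C(#|H|, k - d)]_(S : {set H} | #|S| == d) degree S.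

(* For b <= k, k + (k - b) = 2k - b is the number of vertices of Y_{k,b}; the
   edges are its first k and its last k vertices. *)
Definition Y_edge1 (k b : nat) : {set 'I_(k + (k - b))} :=
  [set i : 'I_(k + (k - b)) | i < k].
Definition Y_edge2 (k b : nat) : {set 'I_(k + (k - b))} :=
  [set i : 'I_(k + (k - b)) | k - b <= i].

Lemma card_ord_lt n m : m <= n -> #|[set i : 'I_n | i < m]| = m.
Proof.
move=> le_mn; have <- : widen_ord le_mn @: [set: 'I_m] = [set i : 'I_n | i < m].
  apply/setP => i; rewrite inE; apply/imsetP/idP => [[j _ ->] //= | lt_im].
  by exists (Ordinal lt_im); [rewrite inE | apply: val_inj].
rewrite card_imset ?cardsT ?card_ord // => i j /(congr1 val) /= ?.
exact: val_inj.
Qed.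

Lemma card_ord_ge n m : #|[set i : 'I_n | m <= i]| = n - m.
Proof.
have [le_mn | lt_nm] := leqP m n; last first.
  rewrite (eqP (ltnW lt_nm : n - m == 0)); apply/eqP; rewrite cards_eq0.
  apply/eqP/setP => i; rewrite !inE leqNgt.
  by rewrite (ltn_trans (ltn_ord i) lt_nm).
have -> : [set i : 'I_n | m <= i] = ~: [set i : 'I_n | i < m].
  by apply/setP => i; rewrite !inE leqNgt.
by rewrite cardsCs setCK card_ord card_ord_lt.
Qed.

Lemma card_Y_edge (k b : nat) (e : {set 'I_(k + (k - b))}) :
  e \in [set Y_edge1 k b; Y_edge2 k b] -> #|e| = k.
Proof.
rewrite !inE => /orP[] /eqP ->.
  by rewrite card_ord_lt // leq_addr.
by rewrite card_ord_ge addnK.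
Qed.

Definition Y (k b : nat) : kgraph k := KGraph (@card_Y_edge k b).

Lemma card_Y_edgeI (k b : nat) : b <= k -> #|Y_edge1 k b :&: Y_edge2 k b| = b.
Proof.
move=> le_bk.
have eqU : Y_edge1 k b :|: Y_edge2 k b = [set: _].
  apply/setP => i; rewrite !inE; case: ltnP => //= le_ki.
  exact: leq_trans (leq_subr _ _) le_ki.
have := cardsUI (Y_edge1 k b) (Y_edge2 k b).
rewrite eqU cardsT card_ord (card_Y_edge (set21 _ _)) (card_Y_edge (set22 _ _)).
by move=> eqk; apply: (@addnI (k + (k - b))); rewrite eqk -addnA subnK.
Qed.

(* A subgraph is given by its vertex set S.1 and its edge set S.2. *)
Definition is_copy (k : nat) (F H : kgraph k)
    (S : {set H} * {set {set H}}) : Prop :=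
  S.2 \subset edge H /\
  exists f : F -> H,
    [/\ injective f,
        S.1 = [set f x | x : F] &
        S.2 = [set f @: (e : {set F}) | e in edge F]].

(* A tiling is given by the set of its components. *)
Definition is_tiling (k : nat) (F H : kgraph k)
    (P : {set {set H} * {set {set H}}}) : Prop :=
  (forall S, S \in P -> is_copy F S) /\
  (forall S S', S \in P -> S' \in P -> S != S' -> [disjoint S.1 & S'.1]).

Definition covered (k : nat) (H : kgraph k)
    (P : {set {set H} * {set {set H}}}) : {set H} :=
  \bigcup_(S in P) S.1.

Definition has_almost_tiling (R : realType) (k : nat) (F H : kgraph k)
    (eps : R) : Prop :=
  exists P : {set {set H} * {set {set H}}},
    is_tiling F P /\ ((#|~: covered P|)%:R <= eps * (#|H|)%:R)%R.

Definition tiling_threshold (R : realType) (k d l n : nat) (eps : R)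
    (t : nat) : Prop :=
  forall H : kgraph k, #|H| = n -> t <= min_degree d H ->
    has_almost_tiling (Y k (2 * l)) H eps.

Lemma min_degree_le (k d : nat) (H : kgraph k) :
  min_degree d H <= 'C(#|H|, k - d).
Proof.
rewrite /min_degree.
by elim/big_rec: _ => // S m _ le_m; rewrite geq_min le_m orbT.
Qed.

Lemma ex_tiling_threshold (R : realType) (k d l n : nat) (eps : R) :
  exists t, `[< tiling_threshold k d l n eps t >].
Proof.
exists ('C(n, k - d)).+1; apply/asboolP => H Hn lt_deg.
by move: (leq_trans lt_deg (min_degree_le d H)); rewrite Hn ltnn.
Qed.

(* t_d^l(k, n, eps) *)
Definition t_fin (R : realType) (k d l n : nat) (eps : R) : nat :=
  ex_minn (ex_tiling_threshold k d l n eps).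

(* t(k, d, l) *)
Definition t_lim (R : realType) (k d l : nat) : \bar R :=
  limf_esup
    (fun eps : R =>
       limn_esup (fun n => ((t_fin k d l n eps)%:R / ('C(n, k - d))%:R)%:E))
    (at_right (0%R : R)).

(* Main.v *)
(** Upper bound.  Take a largest family of disjoint 6-sets spanning [Y_{5,4}],
    and suppose that it misses many vertices.  Fix [K] disjoint pairs of missed
    vertices, and cut the other vertices into blocks: the members of the family
    and 6-sets of missed vertices.  By averaging over [M]-tuples of blocks and a
    Kovari-Sos-Turan argument there are [M] classes of [s] blocks each and
    [s * M + 1] of the pairs such that the traces of the links of these pairs on
    any choice of one block per class form one and the same 3-graph [G] on [6M]
    vertices, with more than [91 M^3] ordered edges.  A copy of [Y_{3,2}] in the
    [s]-fold blow-up of [G] together with one of the pairs is a copy of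
    [Y_{5,4}], so it is enough to find [s * M + 1] disjoint ones: the new copies
    then replace the at most [s * M] members of the family among the blocks used.

    They exist as soon as the fractional tiling number [tau] of [G] exceeds [M]
    by a constant factor, for which one needs [e(G) <= 91 max(tau, M)^3] (ordered
    edges).  Compare an optimal fractional tiling with an optimal fractional cover
    [w]: every tile in use has total weight [1] and missed vertices have weight
    [0].  Padding each tile with two missed vertices splits the vertex set
    fractionally into 6-tuples of weight at most [1], and three such 6-tuples span
    at most [91] edges: [6^3 - 5^3] if all have an entry [1].

    Lower bound.  Take all 5-sets meeting a set of slightly less than [n / 6]
    vertices: every copy of [Y_{5,4}] uses one of these. *)
Require Import Defs.
From mathcomp Require Import all_boot all_order all_algebra.
From mathcomp Require Import boolp reals ereal topology normedtype sequences.
From mathcomp Require classical_sets.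
From mathcomp Require Import lra ring zify.
Set Implicit Arguments.
Unset Strict Implicit.
Unset Printing Implicit Defensive.
Import Order.TTheory GRing.Theory Num.Theory.
Import numFieldNormedType.Exports.

(** * Linear programming duality *)

Section Duality.
Local Open Scope ring_scope.

(* Bartl's induction on the number of forms: if [x0] violates only the last
   form, eliminate that form along [x0]. *)
Lemma farkas_nat (R : realFieldType) (J : finType) (m : nat) :
  forall (A : nat -> J -> R) (c : J -> R),
  (exists z : J -> R, (forall i, (i < m)%N -> \sum_j A i j * z j <= 0) /\
                      0 < \sum_j c j * z j) \/
  (exists l : nat -> R, (forall i, 0 <= l i) /\
                        forall j, c j = \sum_(i < m) l i * A i j).
Proof.
elim: m => [|m IH] A c.
  have [/forallP c0|] := boolP [forall j, c j == 0].
    by right; exists (fun=> 0); split=> // j; rewrite big_ord0; apply/eqP.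
  rewrite negb_forall => /existsP[j0 cj0]; left; exists c; split=> //.
  rewrite (bigD1 j0) //= ltr_pwDl //; first by rewrite -expr2 exprn_even_gt0.
  by apply: sumr_ge0 => j _; rewrite -expr2 sqr_ge0.
have [[x0 [x0A x0c]]|[l [l0 lc]]] := IH A c; last first.
  right; exists (fun i => if (i < m)%N then l i else 0); split=> [i|j].
    by case: ifP.
  rewrite lc big_ord_recr /= ltnn mul0r addr0.
  by apply: eq_bigr => i _; rewrite ltn_ord.
have [le0|gt0] := leP (\sum_j A m j * x0 j) 0.
  left; exists x0; split=> // i; rewrite ltnS leq_eqVlt => /predU1P[->|] //.
  exact: x0A.
set a := \sum_j A m j * x0 j in gt0.
pose x1 j := x0 j / a.
have sx1 (f : J -> R) : \sum_j f j * x1 j = (\sum_j f j * x0 j) / a.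
  by rewrite mulr_suml; apply: eq_bigr => j _; rewrite mulrA.
have am1 : \sum_j A m j * x1 j = 1 by rewrite sx1 divff // gt_eqF.
have x1A i : (i < m)%N -> \sum_j A i j * x1 j <= 0.
  by move=> /x0A H; rewrite sx1 pmulr_lle0 // invr_gt0.
have x1c : 0 < \sum_j c j * x1 j by rewrite sx1 divr_gt0.
(* The new forms vanish at [x1], where the last form has value [1]. A good point [z] for them is
   corrected by a multiple of [x1]; multipliers for them leave a remainder along the last form
   only. *)
pose A' i j := A i j - (\sum_j A i j * x1 j) * A m j.
pose c' j := c j - (\sum_j c j * x1 j) * A m j.
have [[z [zA zc]]|[l [l0 lc]]] := IH A' c'.
  pose b := \sum_j A m j * z j.
  have E (f : J -> R) : \sum_j (f j - (\sum_j f j * x1 j) * A m j) * z j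
      = \sum_j f j * (z j - b * x1 j).
    under eq_bigr do rewrite mulrBl.
    under [RHS]eq_bigr do rewrite mulrBr mulrCA.
    rewrite !big_split /= !sumrN -[X in _ = _ - X]mulr_sumr; congr (_ - _).
    by rewrite mulrC mulr_sumr; apply: eq_bigr => i _; rewrite mulrA.
  left; exists (fun j => z j - b * x1 j); rewrite -E; split=> // i.
  rewrite ltnS leq_eqVlt => /predU1P[->|im]; last by rewrite -E; exact: zA.
  under eq_bigr do rewrite mulrBr mulrCA.
  by rewrite big_split /= sumrN -mulr_sumr am1 mulr1 subrr.
right; exists (fun i => if (i < m)%N then l i else
  \sum_j c j * x1 j - \sum_(i < m) l i * \sum_j A i j * x1 j); split=> [i|j].
  case: ifP => // _; rewrite subr_ge0 (le_trans _ (ltW x1c)) //.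
  by apply: sumr_le0 => k _; rewrite mulr_ge0_le0 // x1A.
rewrite big_ord_recr /= ltnn.
under eq_bigr do rewrite ltn_ord.
have /eqP := lc j; rewrite /c' subr_eq => /eqP ->.
have -> : \sum_(i < m) l i * A' i j = \sum_(i < m) l i * A i j -
    (\sum_(i < m) l i * \sum_j A i j * x1 j) * A m j.
  rewrite mulr_suml -sumrB; apply: eq_bigr => i _.
  by rewrite /A' mulrBr mulrA.
ring.
Qed.

Lemma farkas (R : realFieldType) (I J : finType) (A : I -> J -> R) (c : J -> R) :
  (exists z : J -> R, (forall i, \sum_j A i j * z j <= 0) /\
                      0 < \sum_j c j * z j) \/
  (exists l : I -> R, (forall i, 0 <= l i) /\
                      forall j, c j = \sum_i l i * A i j).
Proof.
have [I0|] := posnP #|I|.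
  have [[z [_ zc]]|[l [_ lc]]] := farkas_nat 0 (fun _ _ => 0) c.
    by left; exists z; split=> // i; have := card0_eq I0 i; rewrite !inE.
  right; exists (fun=> 0); split=> // j; rewrite lc big_ord0 big1 // => i.
  by have := card0_eq I0 i; rewrite !inE.
move=> /card_gt0P[i0 _].
pose B k := A (nth i0 (enum I) k).
have [[z [zA zc]]|[l [l0 lc]]] := farkas_nat #|I| B c.
  left; exists z; split=> // i; rewrite -(nth_index i0 (mem_enum I i)).
  by apply: zA; rewrite cardE index_mem mem_enum.
right; exists (fun i => l (index i (enum I))); split=> // j.
rewrite lc [RHS](reindex (@enum_val I predT)) /=; last first.
  exact/onW_bij/enum_val_bij.
apply: eq_bigr => k _; rewrite /B (enum_val_nth i0) index_uniq ?enum_uniq //.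
by rewrite -cardE.
Qed.

Lemma weak_duality (R : realFieldType) (T V : finType) (A : T -> V -> R)
    (x : T -> R) (w : V -> R) :
  (forall t, 0 <= x t) -> (forall v, 0 <= w v) ->
  (forall v, \sum_t x t * A t v <= 1) -> (forall t, 1 <= \sum_v A t v * w v) ->
  \sum_t x t <= \sum_v w v.
Proof.
move=> x0 w0 xA wA; apply: (@le_trans _ _ (\sum_t x t * \sum_v A t v * w v)).
  by apply: ler_sum => t _; rewrite -[leLHS]mulr1 ler_wpM2l.
under eq_bigr do rewrite mulr_sumr.
rewrite exchange_big; apply: ler_sum => v _ /=.
under eq_bigr do rewrite mulrA.
by rewrite -mulr_suml -[leRHS]mul1r ler_wpM2r.
Qed.

(** Farkas' lemma is applied to a homogeneous system in [x], [w] and a scale [t]: nonnegativity,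
    packing and cover conditions relative to [t], and total of [w] at most that of [x], with
    objective [t]. A solution with positive [t] is divided by [t]; the multipliers of the opposite
    case contradict weak duality. *)
Lemma packing_duality (R : realFieldType) (T V : finType) (A : T -> V -> R) :
  (forall t v, 0 <= A t v) -> (forall t, exists v, 0 < A t v) ->
  exists (x : T -> R) (w : V -> R),
    [/\ (forall t, 0 <= x t) /\ (forall v, 0 <= w v),
        forall v, \sum_t x t * A t v <= 1,
        forall t, 1 <= \sum_v A t v * w v &
        \sum_t x t = \sum_v w v].
Proof.
move=> A0 A1.
pose U : Type := ((T + V) + (V + T + unit))%type.
pose J : Type := ((T + V) + unit)%type.
pose ctr (i : U) (j : J) : R := match i, j with
  | inl (inl t), inl (inl t') => - (t == t')%:R
  | inl (inr v), inl (inr v') => - (v == v')%:R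
  | inr (inl (inl v)), inl (inl t) => A t v
  | inr (inl (inl v)), inr _ => - 1
  | inr (inl (inr t)), inl (inr v) => - A t v
  | inr (inl (inr t)), inr _ => 1
  | inr (inr _), inl (inl _) => - 1
  | inr (inr _), inl (inr _) => 1
  | _, _ => 0 end.
pose obj (j : J) : R := if j is inr _ then 1 else 0.
have s1 (I : finType) (k : I) (z : I -> R) : \sum_i - (k == i)%:R * z i = - z k.
  rewrite (bigD1 k) //= eqxx mulN1r big1 ?addr0 // => i /negPf ik.
  by rewrite eq_sym ik oppr0 mul0r.
have s2 (I : finType) (k : I) (z : I -> R) : \sum_i z i * - (i == k)%:R = - z k.
  by rewrite -s1; apply: eq_bigr => i _; rewrite mulrC eq_sym.
have sJ (f : J -> R) : \sum_j f j = \sum_t f (inl (inl t)) +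
    \sum_v f (inl (inr v)) + f (inr tt).
  by rewrite !big_sumType /= (big_pred1 tt) // => -[].
have sU (f : U -> R) : \sum_i f i = \sum_t f (inl (inl t)) +
    \sum_v f (inl (inr v)) + (\sum_v f (inr (inl (inl v))) +
    \sum_t f (inr (inl (inr t))) + f (inr (inr tt))).
  by rewrite !big_sumType /= (big_pred1 tt) // => -[].
have z1 (I : finType) (f : I -> R) : \sum_i 0 * f i = 0.
  by rewrite big1 // => i _; rewrite mul0r.
have z2 (I : finType) (f : I -> R) : \sum_i f i * 0 = 0.
  by rewrite big1 // => i _; rewrite mulr0.
case: (farkas ctr obj) => [[z [zc z0]]|[l [l0 lc]]].
  have t0 : 0 < z (inr tt) by move: z0; rewrite sJ /= !z1 !add0r mul1r.
  set t := z (inr tt) in t0.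
  have x0 k : 0 <= z (inl k).
    have := zc (inl k); rewrite sJ; case: k => k /=; rewrite s1 z1 mul0r ?addr0 ?add0r.
      by rewrite oppr_le0.
    by rewrite oppr_le0.
  pose x k := z (inl (inl k)) / t; pose w v := z (inl (inr v)) / t.
  have x_ge0 k : 0 <= x k by rewrite divr_ge0 // ltW.
  have w_ge0 k : 0 <= w k by rewrite divr_ge0 // ltW.
  have xA v : \sum_t x t * A t v <= 1.
    have := zc (inr (inl (inl v))); rewrite sJ /= z1 addr0 mulN1r.
    rewrite subr_le0 -/t => le_t.
    under eq_bigr do rewrite mulrAC (mulrC (z _)).
    by rewrite -mulr_suml ler_pdivrMr // mul1r.
  have wA k : 1 <= \sum_v A k v * w v.
    have := zc (inr (inl (inr k))); rewrite sJ /= z1 add0r mul1r.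
    under eq_bigr do rewrite mulNr.
    rewrite sumrN addrC subr_le0 -/t => le_t.
    under eq_bigr do rewrite mulrA.
    by rewrite -mulr_suml ler_pdivlMr // mul1r.
  exists x, w; split=> //; apply/eqP; rewrite eq_le; apply/andP; split.
    exact: weak_duality x_ge0 w_ge0 xA wA.
  have := zc (inr (inr tt)); rewrite sJ /= mul0r addr0.
  under eq_bigr do rewrite mulN1r.
  under [X in _ + X]eq_bigr do rewrite mul1r.
  by rewrite sumrN addrC subr_le0 -!mulr_suml ler_pM2r // invr_gt0.
exfalso.
pose u v := l (inr (inl (inl v))); pose y t := l (inr (inl (inr t))).
pose d := l (inr (inr tt)).
have uA t : d <= \sum_v A t v * u v.
  have := lc (inl (inl t)); rewrite sU s2 /= !z2 mulrN1 !addr0 => E.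
  have := l0 (inl (inl t)); under eq_bigr do rewrite mulrC.
  by move: E; rewrite /d /u; lra.
have yA v : \sum_t y t * A t v <= d.
  have := lc (inl (inr v)); rewrite sU /= s2 !z2 mulr1 !add0r.
  under [X in _ + (X + _)]eq_bigr do rewrite mulrN.
  rewrite sumrN => E; have := l0 (inl (inr v)).
  by move: E; rewrite /d /y; lra.
have uy : \sum_t y t = 1 + \sum_v u v.
  have := lc (inr tt); rewrite sU /= !z2 mulr0 addr0 !add0r.
  rewrite -!mulr_suml mulrN1 mulr1 => E.
  by move: E; rewrite /y /u; lra.
have u0 v : 0 <= u v by exact: l0.
have y0 t : 0 <= y t by exact: l0.
have su : 0 <= \sum_v u v by apply: sumr_ge0.
(* When [d <= 0], the positive entry for each [t] forces [y = 0], although its sum is at least [1].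
   Otherwise [y] and [u] are divided by [d]. *)
have [d0|d0] := leP d 0.
  suff yt0 t : y t = 0 by move: uy; rewrite big1 //; lra.
  have [v Av] := A1 t; apply/eqP; rewrite eq_le y0 andbT leNgt; apply/negP => yt.
  have := yA v; rewrite leNgt => /negP; apply.
  rewrite (bigD1 t) //= (le_lt_trans d0) // ltr_pwDl ?mulr_gt0 //.
  by apply: sumr_ge0 => i _; rewrite mulr_ge0.
have := @weak_duality R T V A (fun t => y t / d) (fun v => u v / d).
rewrite -!mulr_suml ler_pM2r ?invr_gt0 // => H.
suff : \sum_t y t <= \sum_v u v by rewrite uy; lra.
have d0' := ltW d0.
apply: H => [t|v|v|t]; rewrite ?divr_ge0 //.
  under eq_bigr do rewrite mulrAC.
  by rewrite -mulr_suml ler_pdivrMr ?mul1r.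
under eq_bigr do rewrite mulrA.
by rewrite -mulr_suml ler_pdivlMr ?mul1r.
Qed.

End Duality.

(** * Edges spanned by three weighted 6-tuples *)

Lemma sum_bool_le1 (I : finType) (Q P : pred I) :
  (forall i j, Q i -> P i -> Q j -> P j -> i = j) -> \sum_(i | Q i) P i <= 1.
Proof.
move=> H; rewrite -big_mkcondr sum1_card.
by apply/card_le1_eqP => i j /andP[? ?] /andP[? ?]; apply: H.
Qed.

Lemma sum_bool_le (I : finType) (Q P : pred I) : \sum_(i | Q i) P i <= #|Q|.
Proof. by rewrite -sum1_card leq_sum // => i _; case: (P i). Qed.

Section TripleCount.
Variable R : realFieldType.
Implicit Types (x y z : R) (a b c : 'I_4 -> R) (h : R -> nat).

Definition subprob a := (forall i, (0 <= a i)%R) /\ (\sum_i a i <= 1)%R.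

Lemma subprob1 a i : subprob a -> (a i <= 1)%R.
Proof.
move=> [a0 a1]; apply: le_trans a1; rewrite (bigD1 i) //= lerDl.
exact: sumr_ge0.
Qed.

Lemma subprob2 a i j : subprob a -> i != j -> (a i + a j <= 1)%R.
Proof.
move=> [a0 a1] ij; apply: le_trans a1; rewrite (bigD1 i) //= (bigD1 j) ?(eq_sym j) //=.
by rewrite addrA lerDl sumr_ge0.
Qed.

Lemma subprob3 a i j k :
  subprob a -> i != j -> i != k -> j != k -> (a i + a j + a k <= 1)%R.
Proof.
move=> [a0 a1] ij ik jk; apply: le_trans a1.
rewrite (bigD1 i) //= (bigD1 j) ?(eq_sym j) //= (bigD1 k) ?(eq_sym k) ?ij ?ik //=.
by rewrite !addrA lerDl sumr_ge0.
Qed.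

(** Let [j0] and [k0] be places of maxima. A good pair avoiding both forces its two entries and both
    maxima to be [1 / 2], and all good pairs lie in a 2 by 2 square. Otherwise they lie in the cross
    through [(j0, k0)]; if both of its arms are met, each contains only one good pair. *)
Lemma pair_count b c : subprob b -> subprob c ->
  (forall i, (b i < 1)%R) -> (forall i, (c i < 1)%R) ->
  \sum_j \sum_k (1 <= b j + c k)%R <= 4.
Proof.
move=> pb pc b1 c1.
pose e j k := (1 <= b j + c k)%R.
have [j0 j0max] : exists j0, forall j, (b j <= b j0)%R.
  have [j0 _ H] := @arg_maxP _ R _ ord0 predT b isT.
  by exists j0 => j; exact: H.
have [k0 k0max] : exists k0, forall k, (c k <= c k0)%R.
  have [k0 _ H] := @arg_maxP _ R _ ord0 predT c isT.
  by exists k0 => k; exact: H.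
have [/existsP[j /existsP[k /and3P[jj0 kk0 ejk]]]|H] :=
    boolP [exists j, exists k, [&& j != j0, k != k0 & e j k]].
  have := subprob2 pb jj0; have := subprob2 pc kk0.
  have := j0max j; have := k0max k; move: ejk; rewrite /e => Ejk lk lj sk sj.
  have sup j' k' : e j' k' -> (j' \in [:: j0; j]) && (k' \in [:: k0; k]).
    rewrite /e !inE => E; apply/andP; split; apply/negPn/negP.
      rewrite negb_or => /andP[nj0 nj].
      have := subprob3 pb nj0 nj; rewrite eq_sym => /(_ jj0).
      by have := c1 k'; lra.
    rewrite negb_or => /andP[nk0 nk].
    have := subprob3 pc nk0 nk; rewrite eq_sym => /(_ kk0).
    by have := b1 j'; lra.
  apply: (@leq_trans (\sum_(j' in [:: j0; j]) \sum_(k' in [:: k0; k]) 1)).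
    rewrite [X in _ <= X]big_mkcond leq_sum // => j' _.
    rewrite [X in _ <= if _ then X else _]big_mkcond /=.
    case: ifPn => [_|nj].
      apply: leq_sum => k' _; have := sup j' k'; rewrite /e.
      by case: (_ <= _)%R => // /(_ isT)/andP[_ ->].
    rewrite big1 // => k' _; have := sup j' k'; rewrite /e (negPf nj).
    by case: (_ <= _)%R => // /(_ isT).
  rewrite !sum_nat_const muln1.
  by apply: (@leq_trans (2 * 2)) => //; apply: leq_mul; apply: card_size.
have cross j k : j != j0 -> k != k0 -> e j k = false.
  move=> nj nk; apply/negP => ejk; case/negP: H.
  by apply/existsP; exists j; apply/existsP; exists k; rewrite nj nk.
rewrite (bigD1 j0) //= (bigD1 k0) //=.
have -> : \sum_(j < 4 | j != j0) \sum_k (1 <= b j + c k)%R =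
          \sum_(j < 4 | j != j0) e j k0.
  apply: eq_bigr => j nj; rewrite (bigD1 k0) //= big1 ?addn0 // => k nk.
  by have := cross _ _ nj nk; rewrite /e => ->.
set r := \sum_(k < 4 | k != k0) _; set t := \sum_(j < 4 | j != j0) _.
have r3 : r <= 3 by apply: leq_trans (sum_bool_le _ _) _; rewrite cardC1 card_ord.
have t3 : t <= 3 by apply: leq_trans (sum_bool_le _ _) _; rewrite cardC1 card_ord.
have le1 : ((1 <= b j0 + c k0)%R : nat) <= 1 by case: (_ <= _)%R.
have rt : 0 < r -> 0 < t -> r <= 1 /\ t <= 1.
  rewrite /r /t -!big_mkcondr !sum1_card => /card_gt0P[k1 /andP[nk1 ek1]].
  move=> /card_gt0P[j1 /andP[nj1 ej1]]; split.
    apply/card_le1_eqP => k k' /andP[nk ek] /andP[nk' ek'].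
    apply/eqP/negPn/negP => kk'.
    have := subprob3 pc kk' nk' nk; have := subprob2 pb nj1.
    by move: ek ek' ej1 (b1 j0); rewrite /e /=; lra.
  apply/card_le1_eqP => j j' /andP[nj ej] /andP[nj' ej'].
  apply/eqP/negPn/negP => jj'.
  have := subprob3 pb jj' nj' nj; have := subprob2 pc nk1.
  by move: ej ej' ek1 (c1 k0); rewrite /e /=; lra.
lia.
Qed.

(* [a] stands for a 6-tuple whose last two entries are [0]. *)
Definition sum6 h a := \sum_i h (a i) + 2 * h 0%R.

Lemma sum6_exchange (f : R -> R -> nat) a b :
  sum6 (fun x => sum6 (f x) b) a = sum6 (fun y => sum6 (f^~ y) a) b.
Proof.
by rewrite /sum6 !big_split /= !big1_eq exchange_big /=; lia.
Qed.

Lemma eq_sum6 h h' a : (forall x, h x = h' x) -> sum6 h a = sum6 h' a.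
Proof. by move=> E; rewrite /sum6 E; under eq_bigr do rewrite E. Qed.

Lemma leq_sum6 h h' a : (forall x, h x <= h' x) -> sum6 h a <= sum6 h' a.
Proof. by move=> H; rewrite leq_add ?leq_mul // leq_sum. Qed.

Lemma sum6_cst (m : nat) a : sum6 (fun=> m) a = 6 * m.
Proof. by rewrite /sum6 sum_nat_const card_ord -mulnDl. Qed.

(** Such an entry equals [1] and leaves [0] for the others, so five of the six terms are [h 0]. *)
Lemma sum6_special h a i : subprob a -> (1 <= a i)%R ->
  sum6 h a = h 1%R + 5 * h 0%R.
Proof.
move=> pa ai; have ai1 : a i = 1%R by apply/eqP; rewrite eq_le ai subprob1.
rewrite /sum6 (bigD1 i) //= ai1 (eq_bigr (fun=> h 0%R)) => [|j nj].
  by rewrite sum_nat_const cardC1 card_ord -addnA -mulnDl.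
congr h; apply/eqP; rewrite eq_le pa.1 andbT.
by have := subprob2 pa nj; rewrite ai1; lra.
Qed.

Lemma sum6_ge1 a : subprob a -> sum6 (fun x => (1 <= x)%R) a <= 1.
Proof.
move=> pa; rewrite /sum6 (_ : (1 <= 0)%R = false) ?ler10 // muln0 addn0.
apply: sum_bool_le1 => i j _ ai _ aj; apply/eqP/negPn/negP => ij.
by have := subprob2 pa ij; move: ai aj; lra.
Qed.

(** The bound is [6 ^ 2 - 5 ^ 2]: a tuple with an entry [1] gives one row of at most [6] and five
    rows of at most [1]. With all entries below [1], a padded [0] lies in no good pair and
    [pair_count] gives [4]. *)
Lemma sum6_pair b c : subprob b -> subprob c ->
  sum6 (fun x => sum6 (fun y => (1 <= x + y)%R) c) b <= 11.
Proof.
move=> pb pc.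
have sp a a' i : subprob a -> subprob a' -> (1 <= a i)%R ->
    sum6 (fun x => sum6 (fun y => (1 <= x + y)%R) a') a <= 11.
  move=> pa pa' ai; rewrite (sum6_special _ pa ai).
  rewrite [X in 5 * X](eq_sum6 (h' := fun y => (1 <= y)%R)) => [|y]; last first.
    by rewrite add0r.
  apply: (@leq_add _ _ 6 5).
    rewrite -[6]muln1 -(sum6_cst _ a'); apply: leq_sum6 => y; exact: leq_b1.
  by rewrite -[5]muln1 -mulnA leq_mul2l mul1n sum6_ge1.
have [/existsP[i bi]|/existsPn b1] := boolP [exists i, 1 <= b i]%R.
  exact: sp bi.
have [/existsP[i ci]|/existsPn c1] := boolP [exists i, 1 <= c i]%R.
  rewrite sum6_exchange; under eq_sum6 => y do under eq_sum6 => x do rewrite addrC.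
  exact: sp ci.
apply: (@leq_trans 4) => //.
rewrite /sum6.
under eq_bigr => i _ do rewrite addr0 (negPf (b1 i)) addn0.
rewrite [X in _ + 2 * (X + _)]big1 => [|i _]; last by rewrite add0r (negPf (c1 i)).
rewrite addr0 ler10 !addn0.
by apply: pair_count => // i; rewrite ltNge.
Qed.

(** These are the cover conditions of the three tiles that a single edge carries, each with one
    vertex doubled. *)
Definition triple_ok x y z :=
  [&& (1 <= 2 * x + y + z)%R, (1 <= x + 2 * y + z)%R & (1 <= x + y + 2 * z)%R].

(** The bound is [36 + 5 * 11]: an entry [1] allows one full slice and reduces the five others to
    [sum6_pair]. Without such an entry at most [88] triples are left. *)
Lemma sum6_triple a b c : subprob a -> subprob b -> subprob c ->
  sum6 (fun x => sum6 (fun y => sum6 (fun z => triple_ok x y z) c) b) a <= 91.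
Proof.
move=> pa pb pc.
have sp a' b' c' i : subprob a' -> subprob b' -> subprob c' -> (1 <= a' i)%R ->
    sum6 (fun x => sum6 (fun y => sum6 (fun z => triple_ok x y z) c') b') a' <= 91.
  move=> pa' pb' pc' ai; rewrite (sum6_special _ pa' ai).
  apply: (@leq_add _ _ 36 (5 * 11)).
    rewrite -[36]/(6 * (6 * 1)) -(sum6_cst 1 c') -(sum6_cst _ b').
    apply: leq_sum6 => y; apply: leq_sum6 => z; exact: leq_b1.
  rewrite leq_mul2l /= (leq_trans _ (sum6_pair pb' pc')) //.
  apply: leq_sum6 => y; apply: leq_sum6 => z; rewrite /triple_ok mulr0 !add0r.
  by case: (1 <= y + z)%R => //=; exact: leq_b1.
have okC x y z : triple_ok x y z = triple_ok y x z.
  by rewrite /triple_ok andbCA (addrC x) (addrC (2 * x)%R) (addrC x y).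
have okCr x y z : triple_ok x y z = triple_ok x z y.
  by rewrite /triple_ok [X in _ && X]andbC; congr [&& _, _ & _]; rewrite addrAC.
have [/existsP[i ai]|/existsPn a1] := boolP [exists i, 1 <= a i]%R.
  exact: sp ai.
have [/existsP[i bi]|/existsPn b1] := boolP [exists i, 1 <= b i]%R.
  rewrite sum6_exchange.
  under eq_sum6 => y do under eq_sum6 => x do under eq_sum6 => z do rewrite okC.
  exact: sp bi.
have [/existsP[i ci]|/existsPn c1] := boolP [exists i, 1 <= c i]%R.
  under eq_sum6 => y do rewrite sum6_exchange.
  rewrite sum6_exchange.
  under eq_sum6 => z do under eq_sum6 => x do under eq_sum6 => y do rewrite okCr okC.
  exact: sp ci.
have ok0 x y : triple_ok x y 0%R -> (1 <= x + y)%R.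
  by rewrite /triple_ok mulr0 !addr0 => /and3P[].
have okx x : (1 <= x)%R = false -> [/\ triple_ok x 0%R 0%R = false,
    triple_ok 0%R x 0%R = false & triple_ok 0%R 0%R x = false].
  move=> x1; split; apply/negP.
  - by move=> /ok0; rewrite addr0 x1.
  - by move=> /ok0; rewrite add0r x1.
  - by rewrite okCr => /ok0; rewrite add0r x1.
have [_ _ ok00] := okx 0%R (ler10 R).
rewrite /sum6 ok00.
have two a' b' (f : R -> R -> bool) : subprob a' -> subprob b' ->
    (forall i, ~~ (1 <= a' i)%R) -> (forall i, ~~ (1 <= b' i)%R) ->
    (forall x y, f x y -> (1 <= x + y)%R) -> \sum_i \sum_j f (a' i) (b' j) <= 4.
  move=> pa' pb' a1' b1' fle.
  apply: leq_trans (pair_count pa' pb' _ _) => [|i|i]; rewrite ?ltNge //.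
  apply: leq_sum => i _; apply: leq_sum => j _.
  by have := fle (a' i) (b' j); case: (f _ _) => // ->.
have ab := two _ _ (fun x y => triple_ok x y 0%R) pa pb a1 b1 ok0.
have ac := two _ _ (fun x y => triple_ok x 0%R y) pa pc a1 c1
  (fun x y H => ok0 x y (etrans (esym (okCr x 0%R y)) H)).
have bc := two _ _ (fun x y => triple_ok 0%R x y) pb pc b1 c1
  (fun x y H => ok0 x y (etrans (etrans (esym (okCr x 0%R y)) (okC x 0%R y)) H)).
have abc : \sum_i \sum_j \sum_k triple_ok (a i) (b j) (c k) <= 64.
  rewrite (@leq_trans (\sum_(i < 4) \sum_(j < 4) \sum_(k < 4) 1)) //; last first.
    by rewrite !sum_nat_const !card_ord.
  by do 3 (apply: leq_sum => ? _); exact: leq_b1.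
have -> : \sum_i (triple_ok 0%R 0%R (c i) : nat) = 0.
  by rewrite big1 // => i _; have [_ _ ->] := okx _ (negPf (c1 i)).
under eq_bigr => i _.
  have [-> _ _] := okx _ (negPf (a1 i)).
  rewrite big_split /= addn0 mul2n -addnn -big_distrr /= mul2n -addnn.
  over.
under [X in _ + 2 * (X + _)]eq_bigr => i _.
  have [_ -> _] := okx _ (negPf (b1 i)).
  rewrite muln0 addn0.
  over.
rewrite !big_split /=; move: ab ac bc abc => /= ab ac bc abc.
rewrite !addn0 mul2n.
(* The triples without padding, then twice the pairs for each position of a single padded [0]; more
   padding contributes nothing. *)
apply: (@leq_trans (64 + (4 + 4) + (4 + 4) + 4.*2)) => //.
by do ![apply: leq_add]; rewrite ?leq_double.
Qed.

End TripleCount.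

(** * Fractional tilings of 3-graphs *)

Section FractionalTiling.
Variables (R : realFieldType) (V : finType) (G : V -> V -> V -> bool).
Hypothesis symG12 : forall a b c, G a b c = G b a c.
Hypothesis symG23 : forall a b c, G a b c = G a c b.

(* The last two vertices may coincide: such a tile is a copy of [Y_{3,2}] in a
   blow-up of [G]. *)
Definition is_tile (t : {ffun 'I_4 -> V}) :=
  G (t (inord 0)) (t (inord 1)) (t (inord 2)) &&
  G (t (inord 0)) (t (inord 1)) (t (inord 3)).

Definition mult (t : {ffun 'I_4 -> V}) v := \sum_i (t i == v).

Local Open Scope ring_scope.

Lemma sum_mult (f : V -> R) t : \sum_v (mult t v)%:R * f v = \sum_i f (t i).
Proof.
rewrite /mult; under eq_bigr do rewrite natr_sum mulr_suml.
rewrite exchange_big; apply: eq_bigr => i _ /=.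
rewrite (bigD1 (t i)) //= eqxx mul1r big1 ?addr0 // => v /negPf nv.
by rewrite eq_sym nv mul0r.
Qed.

(* Complementary slackness: an optimal tiling misses only vertices of weight
   [0] of an optimal cover, and its tiles have weight [1].  Padding each tile
   with two vertices of weight [0] thus reduces the count to [sum6_triple]. *)
Lemma frac_tiling : exists x : {t | is_tile t} -> R,
  [/\ forall t, 0 <= x t,
      forall v, \sum_t x t * (mult (val t) v)%:R <= 1 &
      forall Q, \sum_t x t <= Q -> #|V|%:R <= 6 * Q ->
        (\sum_a \sum_b \sum_c G a b c)%N%:R <= 91 * Q ^+ 3].
Proof.
pose A (t : {t | is_tile t}) v : R := (mult (val t) v)%:R.
have A1 t : exists v, 0 < A t v.
  exists (val t (inord 0)); rewrite ltr0n /mult (bigD1 (inord 0)) //= eqxx.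
  by rewrite ltn_addr.
have [x [w [[x0 w0] xA wA xw]]] := @packing_duality R _ V A (fun _ _ => ler0n _ _) A1.
exists x; split=> // Q tauQ VQ.
have wG a b c : G a b c -> triple_ok (w a) (w b) (w c).
  have tile a' b' c' : G a' b' c' -> 1 <= w a' + w b' + 2 * w c'.
    move=> Gabc; pose t : {ffun 'I_4 -> V} := [ffun i : 'I_4 => nth c' [:: a'; b'; c'] i].
    have Tt : is_tile t by rewrite /is_tile !ffunE !inordK //= Gabc.
    have := wA (Sub t Tt); rewrite /A sum_mult /= !big_ord_recl big_ord0 !ffunE /=; lra.
  move=> Gabc; have := tile _ _ _ Gabc.
  have := tile a c b; rewrite -symG23 => /(_ Gabc).
  have := tile b c a; rewrite -symG23 -symG12 => /(_ Gabc).
  by rewrite /triple_ok => *; apply/and3P; split; lra.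
pose s v := 1 - \sum_t x t * A t v.
have s0 v : 0 <= s v by rewrite subr_ge0.
have sumxA (f : V -> R) :
    \sum_v (\sum_t x t * A t v) * f v = \sum_t x t * \sum_i f (val t i).
  under eq_bigr do rewrite mulr_suml.
  rewrite exchange_big; apply: eq_bigr => t _ /=.
  by rewrite -sum_mult mulr_sumr; apply: eq_bigr => v _; rewrite mulrA.
have wt (t : {t | is_tile t}) : 1 <= \sum_i w (val t i) by rewrite -sum_mult; exact: wA.
have slack : \sum_v s v * w v + \sum_t x t * (\sum_i w (val t i) - 1) = 0.
  rewrite /s; under eq_bigr do rewrite mulrBl mul1r.
  under [X in _ + X]eq_bigr do rewrite mulrBr mulr1.
  rewrite !sumrB sumxA xw; ring.
have sw v : s v * w v = 0.
  apply/eqP; rewrite eq_le mulr_ge0 // andbT -slack (bigD1 v) //= -addrA lerDl.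
  apply: addr_ge0; apply: sumr_ge0 => i _; rewrite mulr_ge0 ?subr_ge0 //.
  exact: wt.
have xt (t : {t | is_tile t}) : x t * (\sum_i w (val t i) - 1) = 0.
  have sw0 : \sum_v s v * w v = 0 by apply: big1 => v _; apply: sw.
  have t0 (u : {t | is_tile t}) : 0 <= x u * (\sum_i w (val u i) - 1) 
    by rewrite mulr_ge0 // subr_ge0; exact: wt.
  have /eqP := slack; rewrite sw0 add0r psumr_eq0 => [/allP H|u _]; last exact: t0.
  exact/eqP/H/mem_index_enum.
(* [None] is a tuple of six padding vertices; its mass brings the total up to [Q]. *)
pose X (t : option {t | is_tile t}) := if t is Some t then x t else Q - \sum_t x t.
pose W (t : option {t | is_tile t}) i := if t is Some t then w (val t i) else 0.
have X0 t : 0 <= X t by case: t => [t|] //=; rewrite subr_ge0.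
have sumX (f : option {t | is_tile t} -> R) :
    \sum_t f t = f None + \sum_t f (Some t).
  rewrite (bigD1 None) //=; congr (_ + _).
  rewrite (reindex_omap Some id) => [|[]] //=.
  by apply: eq_bigl => t; rewrite eqxx.
(* A sum over vertices is bounded by a weighted sum over padded tiles. With [tau] the total of [x],
   the uncovered mass is [#|V| - 4 * tau] and the padding supplies [6 * Q - 4 * tau], which is
   enough as [#|V| <= 6 * Q]. *)
have key (h : R -> nat) : \sum_v (h (w v))%:R <= \sum_t X t * (sum6 h (W t))%:R.
  have -> : \sum_v (h (w v))%:R = (\sum_v s v) * (h 0)%:R +
      \sum_t x t * \sum_i (h (w (val t i)))%:R.
    rewrite -(sumxA (fun v => (h (w v))%:R)) mulr_suml -big_split /=.
    apply: eq_bigr => v _; have -> : s v * (h 0)%:R = s v * (h (w v))%:R.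
      have [->|/negPf nw] := eqVneq (w v) 0; first by [].
      by move: (sw v) => /eqP; rewrite mulf_eq0 nw orbF => /eqP ->; rewrite !mul0r.
    by rewrite -mulrDl /s subrK mul1r.
  have -> : \sum_v s v = #|V|%:R - 4 * \sum_t x t.
    rewrite /s sumrB sumr_const; congr (_ - _).
    have := sumxA (fun=> 1); under eq_bigr do rewrite mulr1.
    by move=> ->; rewrite -mulr_suml mulrC sumr_const card_ord.
  rewrite sumX /=.
  have -> : sum6 h (W None) = (6 * h 0%R)%N.
    by rewrite /sum6 (eq_bigr (fun=> h 0%R)) // sum_nat_const card_ord -mulnDl.
  have -> : \sum_t x t * (sum6 h (W (Some t)))%:R =
      \sum_t x t * (\sum_i (h (w (val t i)))%:R) + (\sum_t x t) * (2 * (h 0)%:R).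
    rewrite mulr_suml -big_split /=; apply: eq_bigr => t _.
    by rewrite -mulrDr /sum6 natrD natr_sum natrM.
  rewrite natrM; set p := \sum_t x t * _; set tau := \sum_t x t.
  suff : (#|V|%:R - 6 * Q) * (h 0)%:R <= 0 by lra.
  by rewrite mulr_le0_ge0 ?ler0n // subr_le0.
have pW t : X t != 0 -> subprob (W t).
  move=> Xt; split=> [i|]; first by case: t {Xt} => [t|] /=.
  case: t Xt => [t|] /= Xt; last by rewrite big1 // ler01.
  by have /eqP := xt t; rewrite mulf_eq0 (negPf Xt) subr_eq0 => /eqP ->.
apply: (@le_trans _ _ (\sum_a \sum_b \sum_c (triple_ok (w a) (w b) (w c))%:R)).
  rewrite !natr_sum; apply: ler_sum => a _; rewrite !natr_sum; apply: ler_sum => b _.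
  rewrite !natr_sum; apply: ler_sum => c _; rewrite ler_nat.
  by have := wG a b c; case: (G a b c) => // ->.
apply: (@le_trans _ _ (\sum_a \sum_b \sum_t X t *
    (sum6 (fun z => triple_ok (w a) (w b) z) (W t))%:R)).
  by apply: ler_sum => a _; apply: ler_sum => b _; apply: key.
under eq_bigr do rewrite exchange_big /=.
rewrite exchange_big /=.
apply: (@le_trans _ _ (\sum_t X t * \sum_a \sum_u X u *
    (sum6 (fun y => sum6 (fun z => triple_ok (w a) y z) (W t)) (W u))%:R)).
  apply: ler_sum => t _; rewrite mulr_sumr; apply: ler_sum => a _.
  rewrite -mulr_sumr ler_wpM2l //.
  exact: (key (fun y => sum6 (fun z => triple_ok (w a) y z) (W t))).
apply: (@le_trans _ _ (\sum_t X t * \sum_u X u * \sum_r X r *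
    (sum6 (fun x => sum6 (fun y => sum6 (fun z => triple_ok x y z) (W t)) (W u))
       (W r))%:R)).
  apply: ler_sum => t _; rewrite ler_wpM2l // exchange_big /=.
  apply: ler_sum => u _; rewrite -mulr_sumr ler_wpM2l //.
  exact: (key (fun x => sum6 (fun y => sum6 (fun z => triple_ok x y z) (W t)) (W u))).
have XQ : \sum_t X t = Q by rewrite sumX /= subrK.
have bound (f : option {t | is_tile t} -> R) (C : R) :
    (forall t, X t != 0 -> f t <= C) -> \sum_t X t * f t <= Q * C.
  move=> fC; rewrite -XQ mulr_suml; apply: ler_sum => t _.
  have [->|Xt] := eqVneq (X t) 0; first by rewrite !mul0r.
  by rewrite ler_wpM2l // fC.
rewrite (_ : 91 * Q ^+ 3 = Q * (Q * (Q * 91))); last by ring.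
apply: (bound) => t Xt; apply: (bound) => u Xu; apply: (bound) => r Xr.
by rewrite ler_nat; apply: sum6_triple; apply: pW.
Qed.

End FractionalTiling.

(** * Partite hypergraphs of positive density *)

Lemma exists_subset (T : finType) (A : {set T}) k :
  k <= #|A| -> exists2 B : {set T}, B \subset A & #|B| = k.
Proof.
move=> kA; exists [set x in take k (enum A)].
  by apply/subsetP => x; rewrite inE => /mem_take; rewrite mem_enum.
rewrite cardsE (card_uniqP _) ?take_uniq ?enum_uniq // size_takel //.
by rewrite -cardE.
Qed.

Lemma leq_card_bigcup (T C : finType) (P : {set C}) (F : C -> {set T}) :
  #|\bigcup_(c in P) F c| <= \sum_(c in P) #|F c|.
Proof.
elim/big_rec2: _ => [|d m U _ le_m]; first by rewrite cards0.
by rewrite (leq_trans (leq_card_setU _ _)) // leq_add2l.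
Qed.

Lemma pigeonhole_cover (T C : finType) (A : {set T}) (P : {set C}) (F : C -> {set T}) :
  0 < #|A| -> (forall x, x \in A -> exists2 c, c \in P & x \in F c) ->
  exists2 c, c \in P & #|A| <= #|P| * #|F c|.
Proof.
move=> A0 AF; have P0 : 0 < #|P|.
  have /card_gt0P[x /AF[c cP _]] := A0.
  by apply/card_gt0P; exists c.
have [c cP cmax] := eq_bigmax_cond (fun c => #|F c|) P0.
exists c => //; rewrite -cmax.
apply: (@leq_trans #|\bigcup_(c in P) F c|).
  by apply/subset_leq_card/subsetP => x /AF[d dP xd]; apply/bigcupP; exists d.
apply: leq_trans (leq_card_bigcup _ _) _.
rewrite -sum_nat_const; apply: leq_sum => d dP.
exact: (leq_bigmax_cond (F := fun c => #|F c|)).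
Qed.

Section FfunCons.
Variables (B : finType) (M : nat).

Definition ffun_cons (b : B) (g : {ffun 'I_M -> B}) : {ffun 'I_M.+1 -> B} :=
  [ffun i => oapp g b (unlift ord0 i)].

Lemma ffun_cons0 b g : ffun_cons b g ord0 = b.
Proof. by rewrite ffunE unlift_none. Qed.

Lemma ffun_consS b g i : ffun_cons b g (lift ord0 i) = g i.
Proof. by rewrite ffunE liftK. Qed.

Lemma ffun_consE (f : {ffun 'I_M.+1 -> B}) :
  f = ffun_cons (f ord0) [ffun i => f (lift ord0 i)].
Proof.
by apply/ffunP => i; case: (unliftP ord0 i) => [j|] ->;
  rewrite ?ffun_cons0 ?ffun_consS ?ffunE.
Qed.

Lemma card_ffun_cons (E : {set {ffun 'I_M.+1 -> B}}) :
  #|E| = \sum_b #|[set g | ffun_cons b g \in E]|.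
Proof.
under eq_bigr do rewrite -sum1dep_card.
rewrite pair_big_dep /= -sum1_card.
rewrite (reindex (fun p => ffun_cons p.1 p.2)) //=.
exists (fun f => (f ord0, [ffun i => f (lift ord0 i)])) => [[b g]|f] _ /=.
  rewrite ffun_cons0; congr pair; apply/ffunP => i.
  by rewrite ffunE ffun_consS.
by rewrite -ffun_consE.
Qed.

End FfunCons.

(* The Kovari-Sos-Turan argument for partite hypergraphs; the density of [E]
   is at least [1 / D]. *)
Lemma dense_box (s M : nat) : forall D, exists q0, forall B : finType, q0 <= #|B| ->
  forall E : {set {ffun 'I_M -> B}}, #|B| ^ M <= D * #|E| ->
  exists S : 'I_M -> {set B}, (forall i, #|S i| = s) /\
    forall y : {ffun 'I_M -> B}, (forall i, y i \in S i) -> y \in E.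
Proof.
elim: M => [|M IH] D.
  exists 0 => B _ E; rewrite expn0 => DE.
  have /card_gt0P[y yE] : 0 < #|E| by case: #|E| DE; rewrite ?muln0.
  exists (fun=> set0); split=> [[]//|z _].
  by rewrite (_ : z = y) //; apply/ffunP => -[].
(* Enough heavy letters that the tuples lying in fewer than [s] of their fibres account for at most
   half of the guaranteed total. *)
pose K := 4 * D * s.+1.
have [q1 IHq] := IH (4 * D * 2 ^ K).
exists (maxn (2 * D * K).+1 q1) => B; rewrite geq_max => /andP[qK qq1] E DE.
have q0 : 0 < #|B| by apply: leq_trans qK.
set q := #|B| in DE qK q0.
have D0 : 0 < D by case: D DE {K IHq qK} => //; rewrite mul0n leqn0 expn_eq0 -/q; case: q q0.
pose Eb b := [set g | ffun_cons b g \in E].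
have EbM b : #|Eb b| <= q ^ M.
  by rewrite (leq_trans (max_card _)) // card_ffun card_ord.
(* The heavy letters, whose fibres have density at least [1 / (2 * D)]; the light ones carry at most
   half of the guaranteed size of [E]. *)
pose X0 := [set b | q ^ M <= 2 * D * #|Eb b|].
have KX0 : K <= #|X0|.
  suff : q <= 2 * D * #|X0|.
    move=> qX; have := leq_trans (ltnW qK) qX.
    by rewrite leq_mul2l muln_eq0 /= (gtn_eqF D0).
  have H : 2 * D * #|E| <= 2 * D * (#|X0| * q ^ M) + q * q ^ M.
    rewrite card_ffun_cons -/Eb (bigID (mem X0)) /= mulnDr leq_add //.
      rewrite leq_mul2l -sum_nat_const; apply/orP; right.
      by apply: leq_sum => b _; exact: EbM.
    rewrite big_distrr /= (@leq_trans (\sum_(b | b \notin X0) q ^ M)) //.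
      by apply: leq_sum => b; rewrite inE -ltnNge => /ltnW.
    by rewrite sum_nat_const leq_mul2r max_card orbT.
  have qM : 0 < q ^ M by rewrite expn_gt0 q0.
  rewrite -(leq_pmul2r qM); move: H DE; rewrite expnS; nia.
have [X XX0 cX] := exists_subset KX0.
pose d g := #|[set b in X | g \in Eb b]|.
have dK g : d g <= K.
  by rewrite -cX subset_leq_card //; apply/subsetP => b; rewrite inE => /andP[].
have sumd : \sum_(b in X) #|Eb b| = \sum_g d g.
  rewrite /d; under [RHS]eq_bigr do rewrite -sum1dep_card big_mkcondr.
  rewrite exchange_big /=; apply: eq_bigr => b _.
  by rewrite -sum1_card big_mkcond.
pose Gd := [set g | s <= d g].
have qM : 0 < q ^ M by rewrite expn_gt0 q0.
have K0 : 0 < K by rewrite !muln_gt0 D0.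
have GdM : q ^ M <= 4 * D * #|Gd|.
  have H1 : K * q ^ M <= 2 * D * \sum_g d g.
    rewrite -sumd big_distrr /= -cX -sum_nat_const; apply: leq_sum => b bX.
    by have := subsetP XX0 b bX; rewrite inE.
  have H2 : \sum_g d g <= #|Gd| * K + s * q ^ M.
    rewrite (bigID (mem Gd)) /= leq_add //.
      by rewrite -sum_nat_const leq_sum.
    apply: (@leq_trans (\sum_(g | g \notin Gd) s)).
      by apply: leq_sum => g; rewrite inE -ltnNge => /ltnW.
    rewrite sum_nat_const mulnC leq_mul2l (leq_trans (max_card _)) ?orbT //.
    by rewrite card_ffun card_ord.
  have H3 : 4 * D * s <= K by rewrite /K leq_mul2l leqnSn orbT.
  rewrite -(leq_pmul2l K0); move: H1 H2 H3; move: (q ^ M) (\sum_g _) => Q1 Q2.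
  clear -D0; nia.
pose P := [set S : {set B} | (S \subset X) && (#|S| == s)].
(* Each tuple in [Gd] lies in all fibres over some [s]-subset of [X]. A most popular subset becomes
   the first side of the box; its common tuples have density at least [1 / (4 * D * 2 ^ K)], the
   value given to the induction hypothesis. *)
pose F (S : {set B}) := [set g | S \subset [set b in X | g \in Eb b]].
have Gd0 : 0 < #|Gd| by case: #|Gd| GdM => //; rewrite muln0 leqNgt qM.
have [g|S] := pigeonhole_cover (P := P) (F := F) Gd0 _.
  rewrite inE => /exists_subset[S Sg cS]; exists S; rewrite !inE ?cS ?eqxx ?Sg //.
  rewrite andbT (subset_trans Sg) //.
  by apply/subsetP => b; rewrite inE => /andP[].
rewrite inE => /andP[SX /eqP cS] GF.
have cP : #|P| <= 2 ^ K.
  rewrite -cX -card_powerset subset_leq_card //.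
  by apply/subsetP => S'; rewrite !inE => /andP[].
have [|S' [cS' S'F]] := IHq B qq1 (F S).
  apply: leq_trans GdM _; rewrite -[leqRHS]mulnA leq_mul2l (leq_trans GF) ?orbT //.
  by rewrite leq_mul2r cP orbT.
exists (fun i => oapp S' S (unlift ord0 i)); split=> [i|y yS].
  by case: (unlift ord0 i).
rewrite (ffun_consE y); have := S'F [ffun i => y (lift ord0 i)] _.
rewrite inE => H; have := yS ord0; rewrite unlift_none /= => y0.
have /H/subsetP/(_ _ y0) : forall i, [ffun i => y (lift ord0 i)] i \in S' i.
  by move=> i; have := yS (lift ord0 i); rewrite liftK ffunE.
by rewrite !inE => /andP[].
Qed.

(** * Integral tilings of blow-ups *)

(* Occurrences of a vertex are numbered in the lexicographic order of [(i, j)]. *)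
Lemma distinct_copies (V : finType) (r s : nat) (t : 'I_r -> {ffun 'I_4 -> V}) :
  (forall v, \sum_i mult (t i) v <= s) ->
  exists c : 'I_r -> 'I_4 -> 'I_s,
    injective (fun ij : 'I_r * 'I_4 => (t ij.1 ij.2, c ij.1 ij.2)).
Proof.
move=> ts; pose N (ij : 'I_r * 'I_4) := (4 * ij.1 + ij.2)%N.
have Ninj : injective N.
  move=> [i j] [i' j']; rewrite /N /= => E.
  by congr pair; apply: ord_inj; have := ltn_ord j; have := ltn_ord j'; lia.
pose occ ij := [set kl | (t kl.1 kl.2 == t ij.1 ij.2) & (N kl < N ij)].
have occ_lt ij : #|occ ij| < s.
  apply: leq_trans (ts (t ij.1 ij.2)).
  have -> : \sum_i mult (t i) (t ij.1 ij.2) =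
      #|[set kl : 'I_r * 'I_4 | t kl.1 kl.2 == t ij.1 ij.2]|.
    rewrite -sum1dep_card [RHS]big_mkcond /mult pair_bigA /=.
    by apply: eq_bigr => kl _; case: eqP.
  apply: proper_card; apply/properP; split.
    by apply/subsetP => kl; rewrite !inE => /andP[].
  by exists ij; rewrite !inE ?ltnn ?andbF.
have occ_inj kl kl' : t kl.1 kl.2 = t kl'.1 kl'.2 -> #|occ kl| = #|occ kl'| -> kl = kl'.
  wlog lt : kl kl' / N kl < N kl'.
    move=> H; case: (ltngtP (N kl) (N kl')) => [/H//|/H h tE cE|/Ninj //].
    by symmetry; apply: h.
  move=> tE cE; have : #|occ kl| < #|occ kl'|; last by rewrite cE ltnn.
  apply: proper_card; apply/properP; split.
    apply/subsetP => x; rewrite !inE tE => /andP[-> /ltn_trans]; exact.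
  by exists kl; rewrite !inE ?tE ?eqxx ?ltnn ?andbF.
exists (fun i j => Ordinal (occ_lt (i, j))) => -[i j] [i' j'] E.
exact: occ_inj (congr1 fst E) (congr1 (fun p => val p.2) E).
Qed.

Section BlowupTiling.
Variables (R : archiRealFieldType) (V : finType) (G : V -> V -> V -> bool).
Hypothesis symG12 : forall a b c, G a b c = G b a c.
Hypothesis symG23 : forall a b c, G a b c = G a c b.

(** A fractional tiling of total at most [Q] would contradict the edge count. Taking each tile [t]
    the integer part of [s * x t] times loses at most one per tile, so at most [#|V| ^ 4] in all,
    and uses each vertex at most [s] times; [distinct_copies] then separates the occurrences. *)
Lemma blowup_tiling (r s : nat) (Q : R) :
  (0 < #|V|)%N -> (#|V|%:R <= 6 * Q)%R ->
  (91 * Q ^+ 3 < (\sum_a \sum_b \sum_c G a b c)%N%:R)%R ->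
  ((r + #|V| ^ 4)%:R <= s%:R * Q)%R ->
  exists (t : 'I_r -> {ffun 'I_4 -> V}) (c : 'I_r -> 'I_4 -> 'I_s),
    (forall i, is_tile G (t i)) /\
    injective (fun ij : 'I_r * 'I_4 => (t ij.1 ij.2, c ij.1 ij.2)).
Proof.
move=> V0 VQ GQ sQ.
have [x [x0 x1 xQ]] := frac_tiling R symG12 symG23.
have tauQ : (Q < \sum_t x t)%R.
  by rewrite ltNge; apply/negP => /xQ /(_ VQ); rewrite leNgt GQ.
pose m t := Num.truncn (s%:R * x t)%R.
have mle t : ((m t)%:R <= s%:R * x t)%R by rewrite truncn_le mulr_ge0.
pose ts := flatten [seq nseq (m t) (val t) | t : {t | is_tile G t}].
have sum_ts (F : {ffun 'I_4 -> V} -> nat) :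
    \sum_(u <- ts) F u = \sum_t m t * F (val t).
  rewrite big_flatten big_map big_enum /=; apply: eq_bigr => t _.
  by rewrite big_nseq iter_addn_0 mulnC.
have rts : r <= size ts.
  rewrite -sum1_size sum_ts -(ler_nat R).
  under eq_bigr do rewrite muln1.
  have : (\sum_(t : {t | is_tile G t}) (s%:R * x t - 1) <= (\sum_t m t)%N%:R)%R.
    rewrite natr_sum; apply: ler_sum => t _.
    by rewrite lerBlDr natr1 ltW // truncnS_gt.
  rewrite sumrB sumr_const -mulr_sumr => H.
  have cT : #|{: {t | is_tile G t}}| <= #|V| ^ 4.
    rewrite -[X in (_ <= _ ^ X)%N](card_ord 4) -card_ffun.
    exact: leq_card val_inj.
  have : (s%:R * Q <= s%:R * \sum_t x t)%R by rewrite ler_wpM2l // ltW.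
  move: H sQ cT; rewrite natrD -(ler_nat R); set c := (#|_|%:R)%R; lra.
have /card_gt0P[v0 _] := V0.
pose t (i : 'I_r) := nth [ffun=> v0] ts i.
have tT i : is_tile G (t i).
  have : t i \in ts by rewrite mem_nth // (leq_trans _ rts).
  by case/flatten_mapP => u _ /nseqP[-> _]; apply: valP.
have tmult v : \sum_i mult (t i) v <= s.
  apply: (@leq_trans (\sum_(u <- ts) mult u v)).
    rewrite (big_nth [ffun=> v0]) big_mkord (big_ord_widen _ (fun i =>
      mult (nth [ffun=> v0] ts i) v) rts) [leqRHS](bigID (fun i : 'I_(size ts) => i < r)) /=.
    exact: leq_addr.
  rewrite sum_ts -(ler_nat R) natr_sum.
  rewrite (@le_trans _ _ (s%:R * \sum_t x t * (mult (val t) v)%:R)%R) //.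
    rewrite mulr_sumr; apply: ler_sum => u _.
    by rewrite natrM mulrA ler_wpM2r.
  by rewrite -[leRHS]mulr1 ler_wpM2l.
have [c cinj] := distinct_copies tmult.
by exists t, c.
Qed.

End BlowupTiling.

(** * Averaging over tuples of blocks *)

Section Averaging.
Variables (B : finType) (M : nat).
Local Notation q := #|B|.

(** Multiplying by [q ^ 3] avoids the truncated exponent [M - 3]. *)
Lemma card_fix3 (i j k : 'I_M) (a b c : B) : i != j -> i != k -> j != k ->
  q ^ 3 * #|[set y : {ffun 'I_M -> B} | [&& y i == a, y j == b & y k == c]]| = q ^ M.
Proof.
move=> ij ik jk.
pose F l : pred B := if l == i then pred1 a else if l == j then pred1 b else
  if l == k then pred1 c else predT.
have -> : #|[set y : {ffun 'I_M -> B} | [&& y i == a, y j == b & y k == c]]| =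
    #|family F|.
  rewrite cardsE; apply: eq_card => y; rewrite !inE; apply/and3P/familyP.
    move=> [/eqP yi /eqP yj /eqP yk] l; rewrite /F.
    have [->|_] := eqVneq l i; first by rewrite inE yi.
    have [->|_] := eqVneq l j; first by rewrite inE yj.
    by have [->|_] := eqVneq l k; first by rewrite inE yk.
  move=> yF; split; [have := yF i|have := yF j|have := yF k]; rewrite /F ?inE.
  - by rewrite eqxx inE.
  - by rewrite eq_sym (negPf ij) eqxx inE.
  - by rewrite !(eq_sym k) (negPf ik) (negPf jk) eqxx inE.
rewrite card_family foldrE big_map big_enum /=.
have prodD3 (f : 'I_M -> nat) : \prod_l f l =
    f i * f j * f k * \prod_(l | [&& l != i, l != j & l != k]) f l.
  rewrite (bigD1 i) // (bigD1 j) 1?eq_sym // (bigD1 k) ?(eq_sym k) ?ik //= !mulnA.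
  by congr (_ * _); apply: eq_bigl => l; rewrite andbA.
rewrite -[X in _ = _ ^ X](card_ord M) -prod_nat_const !prodD3.
rewrite /F eqxx eq_sym (negPf ij) eqxx !(eq_sym k) (negPf ik) (negPf jk) eqxx !card1.
rewrite !mul1n; congr (_ * _); first by rewrite !expnS expn0 muln1 mulnA.
by apply: eq_bigr => l /and3P[/negPf -> /negPf -> /negPf ->].
Qed.

Lemma sum_fix3 (i j k : 'I_M) (g : B -> B -> B -> nat) :
  i != j -> i != k -> j != k ->
  q ^ 3 * (\sum_(y : {ffun 'I_M -> B}) g (y i) (y j) (y k)) =
  q ^ M * (\sum_a \sum_b \sum_c g a b c).
Proof.
move=> ij ik jk.
rewrite (partition_big (fun y : {ffun 'I_M -> B} => y i) predT) //= !big_distrr /=.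
apply: eq_bigr => a _.
rewrite (partition_big (fun y : {ffun 'I_M -> B} => y j) predT) //= !big_distrr /=.
apply: eq_bigr => b _.
rewrite (partition_big (fun y : {ffun 'I_M -> B} => y k) predT) //= !big_distrr /=.
apply: eq_bigr => c _.
rewrite (eq_bigr (fun=> g a b c)) => [|y /andP[/andP[/eqP -> /eqP ->] /eqP ->]] //.
rewrite sum_nat_const mulnA -(card_fix3 a b c ij ik jk); congr (_ * _ * _).
by rewrite -sum1dep_card -sum1_card; apply: eq_bigl => y; rewrite unfold_in /= andbA.
Qed.

Lemma card_not_injective :
  q * #|[set y : {ffun 'I_M -> B} | ~~ injectiveb y]| <= M ^ 2 * q ^ M.
Proof.
pose A (ij : 'I_M * 'I_M) := [set y : {ffun 'I_M -> B} | (ij.1 != ij.2) && (y ij.1 == y ij.2)].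
have qA ij : q * #|A ij| <= q ^ M.
  case: (eqVneq ij.1 ij.2) => [e|nij].
    rewrite (_ : A ij = set0) ?cards0 ?muln0 //.
    by apply/setP => y; rewrite !inE e eqxx.
  rewrite -[X in _ <= _ ^ X]card_ord -card_ffun -cardsT -cardsX.
  (* Overwriting coordinate [ij.1] of [y] by [b] loses nothing on [A ij]: the old value is still
     found at [ij.2]. *)
  apply: (@leq_card_in _ _ (fun by_ : B * {ffun 'I_M -> B} =>
    [ffun l => if l == ij.1 then by_.1 else by_.2 l])).
  move=> [b y] [b' y']; rewrite !inE /= => /andP[_ /eqP yij] /andP[_ /eqP y'ij] /ffunP E.
  have yl l : l != ij.1 -> y l = y' l.
    by move=> /negPf nl; have := E l; rewrite !ffunE /= nl.
  congr pair; first by have := E ij.1; rewrite !ffunE /= eqxx.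
  apply/ffunP => l; have [->|/yl //] := eqVneq l ij.1.
  by rewrite yij y'ij yl // eq_sym.
apply: (@leq_trans (q * \sum_(ij : 'I_M * 'I_M) #|A ij|)).
  rewrite leq_mul2l; apply/orP; right.
  apply: (@leq_trans #|\bigcup_(ij in [set: 'I_M * 'I_M]) A ij|).
    apply/subset_leq_card/subsetP => y; rewrite inE => /injectivePn[i [j ij yij]].
    by apply/bigcupP; exists (i, j); rewrite ?inE ?ij ?yij /=.
  apply: leq_trans (leq_card_bigcup _ _) _.
  by apply/eq_leq/eq_bigl => ij; rewrite inE.
rewrite big_distrr /= (@leq_trans (\sum_(ij : 'I_M * 'I_M) q ^ M)) ?leq_sum //.
by rewrite sum_nat_const card_prod card_ord.
Qed.

End Averaging.

Lemma sum_pair (I J : finType) (F : I * J -> nat) :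
  \sum_u F u = \sum_i \sum_j F (i, j).
Proof. by rewrite pair_bigA; apply: eq_bigr => -[]. Qed.

Section Patterns.
Variables (B : finType) (M : nat).
Local Notation q := #|B|.
Local Notation Z := (B * 'I_6)%type.
Local Notation X := ('I_M * 'I_6)%type.
Implicit Types (L : Z -> Z -> Z -> bool) (y : {ffun 'I_M -> B}).

(** Triples with a repeated index are excluded, so that the blocks of an edge can be varied
    independently of each other. *)
Definition pattern L y (u v t : X) :=
  [&& u.1 != v.1, u.1 != t.1, v.1 != t.1 &
      L (y u.1, u.2) (y v.1, v.2) (y t.1, t.2)].

Definition pattern_set L y := [set x : X * X * X | pattern L y x.1.1 x.1.2 x.2].

Lemma card_pattern L y : #|pattern_set L y| = \sum_u \sum_v \sum_t pattern L y u v t.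
Proof.
rewrite -sum1dep_card big_mkcond pair_bigA pair_bigA /=.
by apply: eq_bigr => x _; case: pattern.
Qed.

Lemma card_pattern_le L y : #|pattern_set L y| <= 216 * M ^ 3.
Proof.
rewrite (leq_trans (max_card _)) // !card_prod !card_ord.
by rewrite [216]/(6 * 6 * 6); lia.
Qed.

Lemma sum_distinct3 :
  \sum_(i < M) \sum_(j < M) \sum_(k < M) [&& i != j, i != k & j != k] =
  M * (M - 1) * (M - 2).
Proof.
rewrite -[X in X * _ * _]card_ord -mulnA -sum_nat_const; apply: eq_bigr => i _.
rewrite (bigID (xpredC1 i)) /= [X in _ + X]big1 ?addn0; last first.
  by move=> j /negPn/eqP ->; rewrite big1 // => k _; rewrite eqxx.
rewrite subn1 -[X in X.-1]card_ord -(cardC1 i) -sum_nat_const.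
apply: eq_bigr => j nij.
rewrite (eq_bigr (fun k => (k \in ~: [set i; j] : nat))) => [|k _]; last first.
  by rewrite !inE negb_or !(eq_sym k) eq_sym nij.
rewrite -big_mkcond sum1_card cardsCs setCK card_ord cards2 eq_sym nij.
by [].
Qed.

(** Double counting: for each triple of distinct indices the three blocks run uniformly over all
    triples of blocks, equal ones included. *)
Lemma sum_pattern L : q ^ 3 * (\sum_y #|pattern_set L y|) =
  M * (M - 1) * (M - 2) * q ^ M * \sum_a \sum_b \sum_c L a b c.
Proof.
pose g (b1 b2 b3 : B) := \sum_(a < 6) \sum_(b < 6) \sum_(c < 6) L (b1, a) (b2, b) (b3, c).
have gE : \sum_a \sum_b \sum_c L a b c = \sum_b1 \sum_b2 \sum_b3 g b1 b2 b3.
  rewrite sum_pair; apply: eq_bigr => b1 _; rewrite /g.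
  under eq_bigr => a _ do rewrite sum_pair; rewrite exchange_big /=.
  apply: eq_bigr => b2 _.
  under eq_bigr => a _ do under eq_bigr => b _ do rewrite sum_pair.
  under eq_bigr => a _ do rewrite exchange_big /=.
  by rewrite exchange_big.
have yE y : #|pattern_set L y| =
    \sum_i \sum_j \sum_k [&& i != j, i != k & j != k] * g (y i) (y j) (y k).
  rewrite card_pattern sum_pair; apply: eq_bigr => i _; rewrite /g.
  under eq_bigr => a _ do rewrite sum_pair; rewrite exchange_big /=.
  apply: eq_bigr => j _.
  under eq_bigr => a _ do under eq_bigr => b _ do rewrite sum_pair.
  under eq_bigr => a _ do rewrite exchange_big /=.
  rewrite exchange_big; apply: eq_bigr => k _ /=.
  rewrite big_distrr; apply: eq_bigr => a _ /=.
  rewrite big_distrr; apply: eq_bigr => b _ /=.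
  rewrite big_distrr; apply: eq_bigr => c _ /=.
  by rewrite /pattern /= mulnb !andbA.
under eq_bigr do rewrite yE.
rewrite exchange_big -sum_distinct3 -mulnA !big_distrl big_distrr /=.
apply: eq_bigr => i _; rewrite exchange_big /= !big_distrl big_distrr /=.
apply: eq_bigr => j _; rewrite exchange_big /= !big_distrl big_distrr /=.
apply: eq_bigr => k _; rewrite -big_distrr /=.
case: and3P => [[ij ik jk]|_]; last by rewrite !mul0n muln0.
by rewrite !mul1n gE; apply: sum_fix3.
Qed.

End Patterns.

(** * Patterns shared by many links *)

Section PopularPattern.
Variable R : archiRealFieldType.
Local Open Scope ring_scope.

Lemma exists_nat_ge (x : R) : exists2 n : nat, (0 < n)%N & x <= n%:R.
Proof. by exists (Num.truncn x).+1 => //; rewrite ltW // truncnS_gt. Qed.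

(** Passing from [M ^ 3] to the number of triples of distinct indices costs at most
    [3 * (91 + th) * M ^ 2]. As [552 = 6 * 92], this is at most [th / 2 * M ^ 3]. *)
Lemma sum_pattern_ge (B : finType) (M : nat) (th : R)
    (L : B * 'I_6 -> B * 'I_6 -> B * 'I_6 -> bool) :
  0 < th -> th <= 1 -> 552 <= th * M%:R -> (0 < #|B|)%N ->
  (91 + th) * #|B|%:R ^+ 3 <= (\sum_a \sum_b \sum_c L a b c)%N%:R ->
  (91 + th / 2) * M%:R ^+ 3 * (#|B| ^ M)%:R <=
    (\sum_(y : {ffun 'I_M -> B}) #|pattern_set L y|)%N%:R.
Proof.
move=> th0 th1 thM q0 LB; set q : R := #|B|%:R; set Q : R := (_ ^ M)%:R.
have q3 : 0 < q ^+ 3 by rewrite exprn_gt0 // ltr0n.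
have M2 : (2 < M)%N.
  rewrite ltnNge; apply/negP; rewrite -(ler_nat R) => M2.
  have : th * M%:R <= 1 * 2 by apply: ler_pM => //; rewrite ?ltW // ler0n.
  by move: thM; lra.
rewrite -(ler_pM2l q3).
have := congr1 (fun n : nat => n%:R : R) (sum_pattern M L).
rewrite /= natrM natrX -/q => ->.
rewrite 2!natrM -/Q !natrM !natrB; [|lia|lia].
set m := M%:R : R; set S := (\sum_a _)%N%:R.
have m2 : 2 < m by rewrite ltr_nat.
have mm : (91 + th / 2) * m ^+ 3 <= m * (m - 1) * (m - 2) * (91 + th).
  have -> : m * (m - 1) * (m - 2) * (91 + th) = (91 + th / 2) * m ^+ 3 +
      (m ^+ 2 * (th * m / 2 - 3 * (91 + th)) + 2 * m * (91 + th)) by field.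
  rewrite lerDl addr_ge0 //; last by rewrite !mulr_ge0 //; lra.
  by rewrite mulr_ge0 ?sqr_ge0 //; move: thM; rewrite -/m; lra.
have Q0 : 0 <= Q by rewrite ler0n.
have mg : 0 <= m * (m - 1) * (m - 2) by rewrite !mulr_ge0 //; lra.
apply: (@le_trans _ _ (m * (m - 1) * (m - 2) * Q * ((91 + th) * q ^+ 3))).
  have -> : q ^+ 3 * ((91 + th / 2) * m ^+ 3 * Q) =
    ((91 + th / 2) * m ^+ 3) * (Q * q ^+ 3) by ring.
  have -> : m * (m - 1) * (m - 2) * Q * ((91 + th) * q ^+ 3) =
    (m * (m - 1) * (m - 2) * (91 + th)) * (Q * q ^+ 3) by ring.
  by rewrite ler_wpM2r // mulr_ge0 // ltW.
by rewrite ler_wpM2l // mulr_ge0.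
Qed.

(** The surplus over [91 + th / 6] is [th / 3]. Non-injective tuples take at most [th / 6] of it and
    rarely shared patterns [th / 12]; the remaining [th / 12] explains [2592 = 12 * 216]. *)
Lemma count_arith (th k a Q N e x : R) :
  k * ((91 + th / 2) * a * Q) <=
    216 * k * a * N + 216 * k * a * e + (216 * x * a + k * ((91 + th / 6) * a)) * Q ->
  k * a * (1296 * N) <= k * a * (th * Q) -> a * Q * (2592 * x) <= a * Q * (th * k) ->
  k * a * (th * Q) <= k * a * (2592 * e).
Proof. lra. Qed.

(** If a tuple is injective and no large pattern is shared by [r] links, then at most [Pat * r]
    links have a large pattern there, which for large [K] is below average. Hence tuples with a
    shared large pattern have positive density, and some choice of a pattern and a set of links
    accounts for a fixed share of them. *)
Lemma popular_pattern (th : R) (M r : nat) :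
  0 < th -> th <= 1 -> 552 <= th * M%:R ->
  exists K D q0 : nat, forall B : finType, (q0 <= #|B|)%N ->
  forall L : 'I_K -> B * 'I_6 -> B * 'I_6 -> B * 'I_6 -> bool,
  (forall p, (91 + th) * #|B|%:R ^+ 3 <= (\sum_a \sum_b \sum_c L p a b c)%N%:R) ->
  exists (G : {set ('I_M * 'I_6) * ('I_M * 'I_6) * ('I_M * 'I_6)}) (P : {set 'I_K}),
    [/\ (91 + th / 6) * M%:R ^+ 3 <= #|G|%:R, (r <= #|P|)%N &
        (#|B| ^ M <= D * #|[set y : {ffun 'I_M -> B} | injectiveb y &&
                              [forall p in P, pattern_set (L p) y == G]]|)%N].
Proof.
move=> th0 th1 thM.
pose X := ('I_M * 'I_6)%type.
(* The number of possible patterns depends on [M] alone, so [K] may be chosen after it. *)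
have [Pat PatE] : exists Pat, #|{set X * X * X}| = Pat by eexists.
have [K K0 thK] := exists_nat_ge (2592 * r%:R * Pat%:R / th).
have [D0 D00 thD] := exists_nat_ge (2592 / th).
have [q0 q00 thq] := exists_nat_ge (1296 * M%:R ^+ 2 / th).
have m0 : 0 < M%:R :> R.
  by rewrite -(pmulr_rgt0 _ th0); apply: lt_le_trans thM; rewrite ltr0n.
have [C CE C0] : exists2 C : R, C = 216 & 0 <= C by exists 216; rewrite ?ler0n.
have [W WE W0] : exists2 W : R, W = 91 + th / 6 & 0 <= W.
  by exists (91 + th / 6); rewrite // addr_ge0 ?ler0n ?divr_ge0 ?ler0n ?(ltW th0).
exists K, (D0 * (Pat * 2 ^ K))%N, q0 => B qB L LB.
have B0 : (0 < #|B|)%N by apply: leq_trans qB.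
pose P := [set c : {set X * X * X} * {set 'I_K} |
  (W * M%:R ^+ 3 <= #|c.1|%:R) && (r <= #|c.2|)%N].
pose F (c : {set X * X * X} * {set 'I_K}) := [set y : {ffun 'I_M -> B} |
  injectiveb y && [forall p in c.2, pattern_set (L p) y == c.1]].
pose E := \bigcup_(c in P) F c.
pose bad := [set y : {ffun 'I_M -> B} | ~~ injectiveb y].
pose A : R := M%:R ^+ 3.
have A0 : 0 < A by rewrite exprn_gt0.
(* Tuples in [bad] or [E] get the trivial bound; the others have few links with large patterns. *)
have sum_le y : (\sum_p #|pattern_set (L p) y|)%N%:R <=
    C * K%:R * A * (y \in bad)%:R + C * K%:R * A * (y \in E)%:R +
    (C * (Pat * r)%N%:R * A + K%:R * (W * A)).
  have le1 p : #|pattern_set (L p) y|%:R <= C * A :> R.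
    by rewrite CE /A -natrX -natrM ler_nat card_pattern_le.
  have triv : (\sum_p #|pattern_set (L p) y|)%N%:R <= C * K%:R * A.
    rewrite natr_sum (le_trans (ler_sum _ (fun p _ => le1 p))) //.
    by rewrite sumr_const card_ord -[_ *+ K]mulr_natr mulrAC.
  have KA : 0 <= C * K%:R * A by rewrite !mulr_ge0 // ltW.
  have rest : 0 <= C * (Pat * r)%N%:R * A + K%:R * (W * A).
    by apply: addr_ge0; rewrite !mulr_ge0 // ltW.
  have [yb|yb] := boolP (y \in bad).
    by rewrite mulr1; apply: le_trans triv _; rewrite -addrA lerDl addr_ge0 // mulr_ge0.
  have [yE|yE] := boolP (y \in E).
    by rewrite mulr1 mulr0 add0r; apply: le_trans triv _; rewrite lerDl.
  rewrite !mulr0 !add0r.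
  pose big := [set p | W * A <= #|pattern_set (L p) y|%:R].
  have cbig : (#|big| <= Pat * r)%N.
    have [->|big0] := posnP #|big|; first by [].
    pose Gs := [set G : {set X * X * X} | W * A <= #|G|%:R].
    have [p|G] := pigeonhole_cover (P := Gs)
      (F := fun G => [set p | pattern_set (L p) y == G]) big0 _.
      by rewrite inE => bp; exists (pattern_set (L p) y); rewrite inE.
    rewrite inE => bG /leq_trans; apply; apply: leq_mul.
      by rewrite -PatE max_card.
    rewrite leqNgt; apply/negP => /ltnW rG; case/negP: yE.
    apply/bigcupP; exists (G, [set p | pattern_set (L p) y == G]).
      by rewrite inE /= bG.
    rewrite inE; move: yb; rewrite inE negbK => -> /=.
    by apply/forall_inP => p; rewrite inE.
  rewrite natr_sum (bigID (mem big)) /= lerD //.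
    apply: (@le_trans _ _ (\sum_(p in big) C * A)); first exact: ler_sum.
    rewrite sumr_const -[_ * A *+ _]mulr_natr mulrAC ler_wpM2r ?(ltW A0) // ler_wpM2l //.
    by rewrite ler_nat.
  apply: (@le_trans _ _ (\sum_(p | p \notin big) W * A)).
    by apply: ler_sum => p; rewrite inE -ltNge => /ltW.
  rewrite sumr_const -[_ * A *+ _]mulr_natl ler_wpM2r ?mulr_ge0 ?(ltW A0) //.
  by rewrite ler_nat (leq_trans (max_card _)) ?card_ord.
pose Q : R := (#|B| ^ M)%:R.
have Q0 : 0 < Q by rewrite ltr0n expn_gt0 B0.
have card_sum (S : {set {ffun 'I_M -> B}}) : \sum_y (y \in S)%:R = #|S|%:R :> R.
  rewrite -sum1_card natr_sum [RHS]big_mkcond.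
  by apply: eq_bigr => y _; case: (y \in S).
have total : K%:R * ((91 + th / 2) * A * Q) <=
    C * K%:R * A * #|bad|%:R + C * K%:R * A * #|E|%:R +
    (C * (Pat * r)%N%:R * A + K%:R * (W * A)) * Q.
  apply: (@le_trans _ _ (\sum_y (\sum_p #|pattern_set (L p) y|)%N%:R)).
    under eq_bigr do rewrite natr_sum.
    rewrite exchange_big /= -[K in K%:R](card_ord K) mulr_natl -sumr_const.
    by apply: ler_sum => p _; rewrite -natr_sum; apply: sum_pattern_ge.
  rewrite (le_trans (ler_sum _ (fun y _ => sum_le y))) // !big_split /= lerD //.
    by rewrite -!mulr_sumr !card_sum.
  by rewrite !sumr_const card_ffun card_ord -mulrnDl -[leLHS]mulr_natr.
have EQ : th * Q <= 2592 * #|E|%:R.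
  have nbad : 1296 * #|bad|%:R <= th * Q.
    have := card_not_injective B M; rewrite -(ler_nat R) !natrM -expr2 -/Q => H.
    have thqB : 1296 * M%:R ^+ 2 <= th * #|B|%:R.
      rewrite -ler_pdivrMl // mulrC (le_trans thq) // ler_nat //.
    have M20 : 0 < M%:R ^+ 2 :> R by rewrite exprn_gt0.
    rewrite -(ler_pM2l M20).
    apply: (@le_trans _ _ (th * #|B|%:R * #|bad|%:R)).
      by rewrite mulrCA mulrA ler_wpM2r.
    by rewrite -mulrA [leRHS]mulrCA ler_wpM2l // ltW.
  have rK : 2592 * (Pat * r)%N%:R <= th * K%:R.
    by rewrite -ler_pdivrMl // mulrC (le_trans _ thK) // natrM -!mulrA (mulrCA Pat%:R).
  have k0 : 0 < K%:R :> R by rewrite ltr0n.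
  have KQA : 0 < K%:R * A by rewrite mulr_gt0.
  have h1 : K%:R * A * (1296 * #|bad|%:R) <= K%:R * A * (th * Q) by rewrite ler_pM2l.
  have h2 : A * Q * (2592 * (Pat * r)%N%:R) <= A * Q * (th * K%:R).
    by rewrite ler_pM2l // mulr_gt0.
  rewrite -(ler_pM2l KQA); rewrite CE WE in total; exact: count_arith total h1 h2.
have E0 : (0 < #|E|)%N.
  have : 0 < 2592 * #|E|%:R :> R by apply: lt_le_trans EQ; rewrite mulr_gt0.
  by rewrite -natrM ltr0n muln_gt0 => /andP[].
have [y /bigcupP[c cP yc]|[G Pi]] := pigeonhole_cover (P := P) (F := F) E0 _.
  by exists c.
rewrite inE /= => /andP[bG rPi] EF; exists G, Pi; split; rewrite -?WE //.
have QE : (#|B| ^ M <= D0 * #|E|)%N.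
  rewrite -(ler_nat R) natrM -/Q -(ler_pM2l th0) (le_trans EQ) //.
  by rewrite mulrA ler_wpM2r // mulrC -ler_pdivrMr.
rewrite (leq_trans QE) // -mulnA leq_mul2l (leq_trans EF) ?orbT // leq_mul2r.
rewrite (leq_trans (max_card _)) ?orbT // card_prod PatE.
by rewrite -[#|{: {set 'I_K}}|]cardsT -powersetT card_powerset cardsT card_ord.
Qed.

End PopularPattern.

(** * Disjoint tiles spread over many links *)

Section DisjointTiles.
Variable R : archiRealFieldType.

(** [popular_pattern] makes many links agree on a pattern for a positive proportion of block tuples,
    and [dense_box] turns these into classes with free choice of blocks. A tiling of the blow-up of
    the pattern is then realised in the blocks, with a different link for each tile. *)
Lemma many_disjoint_tiles (th : R) : (0 < th)%R -> (th <= 1)%R ->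
  exists K q0 : nat, forall B : finType, q0 <= #|B| ->
  forall L : 'I_K -> B * 'I_6 -> B * 'I_6 -> B * 'I_6 -> bool,
  (forall p a b c, L p a b c = L p b a c) ->
  (forall p a b c, L p a b c = L p a c b) ->
  (forall p, ((91 + th) * #|B|%:R ^+ 3 <= (\sum_a \sum_b \sum_c L p a b c)%N%:R)%R) ->
  exists (r : nat) (B' : {set B}) (p : 'I_r -> 'I_K) (f : 'I_r -> 'I_4 -> B * 'I_6),
    [/\ #|B'| < r, injective p, injective (fun ij => f ij.1 ij.2),
        forall i j, (f i j).1 \in B' &
        forall i, L (p i) (f i (inord 0)) (f i (inord 1)) (f i (inord 2)) &&
                  L (p i) (f i (inord 0)) (f i (inord 1)) (f i (inord 3))].
Proof.
move=> th0 th1.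
have [M M0 thM] := exists_nat_ge (552 / th)%R.
have {}thM : (552 <= th * M%:R)%R by rewrite mulrC -ler_pdivrMr.
have m0 : (0 < M%:R :> R)%R by rewrite ltr0n.
pose X := ('I_M * 'I_6)%type.
have cX : #|{: X}| = M * 6 by rewrite card_prod !card_ord.
(* Chosen with [91 * (1 + ka) ^ 3 < 91 + th / 6]: the cube is at most [1 + 7 * ka], and
   [6 * 91 * 7 < 4000]. *)
pose ka : R := (th / 4000)%R.
(* Then [s * M * ka] pays for the rounding loss and for the one tile by which [r] exceeds the number
   of blocks in [M] classes of size [s]. *)
have [s s0 sM] := exists_nat_ge ((1 + (#|{: X}| ^ 4)%:R) / (M%:R * ka))%R.
pose r := (s * M).+1.
have [K [D [q1 Hpop]]] := popular_pattern r th0 th1 thM.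
have [q2 Hbox] := dense_box s M D.
exists K, (maxn q1 q2) => B; rewrite geq_max => /andP[qB1 qB2] L symL12 symL23 LB.
have [G [Pi [bG rPi dens]]] := Hpop B qB1 L LB.
have [S [cS boxS]] := Hbox B qB2 _ dens.
have S0 i : exists b, b \in S i by apply/card_gt0P; rewrite cS.
pose y0 : {ffun 'I_M -> B} := [ffun i => xchoose (S0 i)].
have y0S i : y0 i \in S i by rewrite ffunE; apply: xchooseP.
have good (y : {ffun 'I_M -> B}) : (forall i, y i \in S i) ->
    injective y /\ forall p, p \in Pi -> pattern_set (L p) y = G.
  move=> /boxS; rewrite inE => /andP[/injectiveP yi /forall_inP yG].
  by split=> // p /yG/eqP.
(* A block in two classes would give a tuple of the box that is not injective. *)
have disS i j b : b \in S i -> b \in S j -> i = j.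
  move=> bi bj; pose y : {ffun 'I_M -> B} :=
    [ffun l => if (l == i) || (l == j) then b else y0 l].
  have [|+ _] := good y; last by apply; rewrite !ffunE !eqxx orbT.
  by move=> l; rewrite ffunE; case: ifP => [/orP[] /eqP ->|].
have [p0 p0Pi] : exists p0, p0 \in Pi.
  by apply/card_gt0P; apply: leq_trans rPi.
pose g u v t := ((u, v), t) \in G.
have gE u v t : g u v t = pattern (L p0) y0 u v t.
  by rewrite /g -((good y0 y0S).2 p0 p0Pi) inE.
have gL u v t b1 b2 b3 p : p \in Pi -> g u v t ->
    b1 \in S u.1 -> b2 \in S v.1 -> b3 \in S t.1 ->
    L p (b1, u.2) (b2, v.2) (b3, t.2).
  move=> pPi guvt b1S b2S b3S.
  have := guvt; rewrite gE => /and4P[uv ut vt _].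
  pose y : {ffun 'I_M -> B} := [ffun l => if l == u.1 then b1 else if l == v.1 then b2
             else if l == t.1 then b3 else y0 l].
  have yS l : y l \in S l.
    rewrite ffunE; have [->//|_] := eqVneq l u.1.
    by have [->//|_] := eqVneq l v.1; have [->//|_] := eqVneq l t.1.
  have := guvt; rewrite /g -((good y yS).2 p pPi) inE => /and4P[_ _ _] /=.
  have -> : y u.1 = b1 by rewrite ffunE eqxx.
  have -> : y v.1 = b2 by rewrite ffunE eq_sym (negPf uv) eqxx.
  suff -> : y t.1 = b3 by [].
  by rewrite ffunE eq_sym (negPf ut) eq_sym (negPf vt) eqxx.
have symg12 u v t : g u v t = g v u t.
  rewrite !gE /pattern symL12 eq_sym; congr (_ && _).
  by rewrite andbCA.
have symg23 u v t : g u v t = g u t v.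
  by rewrite !gE /pattern symL23 andbCA (eq_sym v.1).
have cG : (\sum_u \sum_v \sum_t g u v t)%N = #|G|.
  rewrite -((good y0 y0S).2 p0 p0Pi) card_pattern.
  by apply: eq_bigr => u _; apply: eq_bigr => v _; apply: eq_bigr => t _; rewrite gE.
pose Q : R := (M%:R * (1 + ka))%R.
have ka0 : (0 < ka)%R by rewrite divr_gt0 ?ltr0n.
have [|||| t [c [tile inj]]] := @blowup_tiling R _ g symg12 symg23 r s Q.
- by rewrite cX muln_gt0 M0.
- by rewrite cX natrM /Q; have h := mulr_gt0 m0 ka0; clear -h; lra.
- rewrite cG (lt_le_trans _ bG) // /Q exprMn mulrCA mulrC ltr_pM2r ?exprn_gt0 //.
  have k1 : (ka <= 1)%R by rewrite /ka; clear -th1; lra.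
  have k2 : (ka ^+ 2 <= ka)%R by rewrite expr2 ler_piMl // ltW.
  have k3 : (ka ^+ 3 <= ka)%R by rewrite exprS (le_trans _ k2) // expr2 ler_wpM2l // ltW.
  have -> : ((1 + ka) ^+ 3 = 1 + 3 * ka + 3 * ka ^+ 2 + ka ^+ 3)%R by ring.
  by move: k2 k3; rewrite /ka; clear -th0; lra.
- have : ((1 + (#|{: X}| ^ 4)%:R) <= s%:R * (M%:R * ka))%R.
    by rewrite -ler_pdivrMr // mulr_gt0.
  by rewrite natrD /r -[(s * M).+1]addn1 natrD natrM /Q mulrDr mulr1 mulrDr; clear; lra.
(* Tile [i] receives the [i]-th link of [Pi], and the copy number [c i j] selects a block in the
   class of the vertex [t i j]. *)
exists r, (\bigcup_(i in [set: 'I_M]) S i), (fun i => enum_val (widen_ord rPi i)),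
  (fun i j => (nth (y0 (t i j).1) (enum (S (t i j).1)) (c i j), (t i j).2)).
have fS i j : nth (y0 (t i j).1) (enum (S (t i j).1)) (c i j) \in S (t i j).1.
  by rewrite -mem_enum mem_nth // -cardE cS.
split.
- rewrite ltnS (leq_trans (leq_card_bigcup _ _)) //.
  by rewrite (eq_bigr (fun=> s)) // sum_nat_const cardsT card_ord mulnC.
- by move=> i j /enum_val_inj/(congr1 val) /= ij; apply: ord_inj.
- move=> [i j] [i' j'] /= [bE tE]; apply: inj => /=.
  have t1 : (t i j).1 = (t i' j').1.
    by apply: (disS _ _ _ (fS i j)); rewrite bE.
  have tt : t i j = t i' j' by rewrite [LHS]surjective_pairing t1 tE -surjective_pairing.
  congr pair => //; move: bE; rewrite tt => /eqP.
  by rewrite nth_uniq -?cardE ?cS ?enum_uniq // => /eqP/ord_inj.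
- by move=> i j; apply/bigcupP; exists (t i j).1; [rewrite inE | exact: fS].
- by move=> i; have /andP[? ?] := tile i; rewrite !gL ?enum_valP.
Qed.

End DisjointTiles.

(** * Enlarging a family of disjoint copies *)

Lemma ge6_orderings (V : finType) (x y z : V) (A : {set V * V * V}) :
  x != y -> x != z -> y != z ->
  all (mem A) [:: (x, y, z); (x, z, y); (y, x, z); (y, z, x); (z, x, y); (z, y, x)] ->
  6 <= #|A|.
Proof.
move=> xy xz yz /allP sA; set s := (X in {in X, _}) in sA.
have us : uniq s.
  rewrite /s /= !inE !xpair_eqE !eqxx !(eq_sym y x) !(eq_sym z x) !(eq_sym z y).
  by rewrite (negPf xy) (negPf xz) (negPf yz).
by rewrite -[6]/(size s) -(card_uniqP us) subset_leq_card //; apply/subsetP.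
Qed.

(** Each set of [T] is counted at least six times on the right, once for each ordering of its
    elements. *)
Lemma card_3sets_le (Z V : finType) (b : Z -> V) (T : {set {set V}}) :
  injective b -> (forall A, A \in T -> #|A| = 3 /\ A \subset b @: setT) ->
  6 * #|T| <= \sum_x \sum_y \sum_z ([set b x; b y; b z] \in T).
Proof.
move=> binj TP.
have -> : \sum_x \sum_y \sum_z ([set b x; b y; b z] \in T) =
    \sum_(A in T) #|[set t : Z * Z * Z | [set b t.1.1; b t.1.2; b t.2] == A]|.
  rewrite pair_bigA pair_bigA /=.
  under [RHS]eq_bigr do rewrite -sum1dep_card big_mkcond /=.
  rewrite exchange_big /=; apply: eq_bigr => t _.
  rewrite big_mkcond (bigD1 [set b t.1.1; b t.1.2; b t.2]) //= eqxx big1 ?addn0.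
    by case: (_ \in T).
  by move=> A /negPf nA; rewrite eq_sym nA if_same.
rewrite mulnC -sum_nat_const; apply: leq_sum => A /TP[cA Ab].
have [u [v [w [uA vA wA [uv vw wu]]]]] : exists u v w,
    [/\ u \in A, v \in A, w \in A & [/\ u != v, v != w & w != u]].
  have /card_gt2P[u [v [w [[? ? ?] ?]]]] : 2 < #|A| by rewrite cA.
  by exists u, v, w.
have eA : A = [set u; v; w].
  apply/esym/eqP; rewrite eqEcard; apply/andP; split.
    by apply/subsetP => x; rewrite !inE => /orP[/orP[]|] /eqP ->.
  by rewrite cA -setUA cardsU1 cards2 !inE negb_or uv vw eq_sym wu.
have /imsetP[x _ ux] := subsetP Ab _ uA.
have /imsetP[y _ vy] := subsetP Ab _ vA.
have /imsetP[z _ wz] := subsetP Ab _ wA.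
apply: (@ge6_orderings _ x y z).
- by apply: contraNneq uv => xy; rewrite ux vy xy.
- by apply: contraNneq wu => xz; rewrite ux wz xz.
- by apply: contraNneq vw => yz; rewrite vy wz yz.
rewrite /= !inE /= -ux -vy -wz eA.
by rewrite !andbT; do ?[apply/andP; split]; apply/eqP/setP => t; rewrite !inE;
  case: (t == u); case: (t == v); case: (t == w).
Qed.

(** Such a set is listed by some triple whose first entry lies outside [W]. *)
Lemma card_3sets_meeting (V : finType) (W : {set V}) :
  #|[set A : {set V} | (#|A| == 3) && ~~ (A \subset W)]| <= #|~: W| * #|V| ^ 2.
Proof.
pose g (t : V * V * V) := [set t.1.1; t.1.2; t.2].
rewrite (expnS _ 1) expn1 mulnA -cardsT -!cardsX.
apply: leq_trans (leq_imset_card g _).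
apply/subset_leq_card/subsetP => A; rewrite inE => /andP[/eqP cA].
case/subsetPn => x xA xW.
have := cardsD1 x A; rewrite cA xA add1n => -[/esym/eqP/cards2P[y [z [yz Ax]]]].
apply/imsetP; exists (x, y, z); first by rewrite !inE xW.
by rewrite /g /= -[LHS](setD1K xA) Ax setUA.
Qed.

Lemma maximal_6packing (T : finType) (A : {set T}) :
  exists D : {set {set T}}, [/\ trivIset D,
    forall C, C \in D -> #|C| = 6 /\ C \subset A & #|A :\: cover D| < 6].
Proof.
pose P (D : {set {set T}}) := trivIset D && [forall C in D, (#|C| == 6) && (C \subset A)].
have P0 : P set0.
  rewrite /P; apply/andP; split; last by apply/forall_inP => C; rewrite inE.
  by apply/trivIsetP => C; rewrite inE.
have [D /andP[tD /forall_inP sD] maxD] := arg_maxnP (fun D : {set {set T}} => #|D|) P0.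
exists D; split=> // [C /sD/andP[/eqP ? ?]|] //.
rewrite ltnNge; apply/negP => /exists_subset[C Csub cC].
have CD : C \notin D.
  apply/negP => CD.
  have [x xC] : exists x, x \in C by apply/card_gt0P; rewrite cC.
  have := subsetP Csub x xC; rewrite inE => /andP[/negP + _]; apply.
  by apply/bigcupP; exists C.
have dC E : E \in D -> [disjoint C & E].
  move=> ED; rewrite -setI_eq0; apply/eqP/setP => x; rewrite !inE.
  apply/negP => /andP[/(subsetP Csub)]; rewrite inE => /andP[/negP + _] xE; apply.
  by apply/bigcupP; exists E.
suff PC : P (C |: D) by have /= := maxD _ PC; rewrite /geq /= cardsU1 CD ltnn.
apply/andP; split.
  apply/trivIsetP => E E'; rewrite !inE => /predU1P[->|ED] /predU1P[->|E'D] EE'.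
  - by rewrite eqxx in EE'.
  - exact: dC.
  - by rewrite disjoint_sym dC.
  - exact: (trivIsetP tD).
apply/forall_inP => E; rewrite !inE => /predU1P[->|/sD //].
by rewrite cC (subset_trans Csub) ?subsetDl.
Qed.

Lemma copy_of_Y (H : kgraph 5) (f : 'I_6 -> H) : injective f ->
  [set f (inord 0); f (inord 1); f (inord 2); f (inord 3); f (inord 4)] \in edge H ->
  [set f (inord 1); f (inord 2); f (inord 3); f (inord 4); f (inord 5)] \in edge H ->
  exists E, is_copy (Y 5 4) (f @: setT, E).
Proof.
move=> finj e1 e2.
have E1 : f @: (Y_edge1 5 4 : {set 'I_6}) =
    [set f (inord 0); f (inord 1); f (inord 2); f (inord 3); f (inord 4)].
  have -> : (Y_edge1 5 4 : {set 'I_6}) =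
      [set inord 0; inord 1; inord 2; inord 3; inord 4].
    apply/setP => -[k lk]; rewrite !inE -!val_eqE /= !inordK //.
    by move: k lk; do 6 case=> //.
  by rewrite !imsetU !imset_set1.
have E2 : f @: (Y_edge2 5 4 : {set 'I_6}) =
    [set f (inord 1); f (inord 2); f (inord 3); f (inord 4); f (inord 5)].
  have -> : (Y_edge2 5 4 : {set 'I_6}) =
      [set inord 1; inord 2; inord 3; inord 4; inord 5].
    apply/setP => -[k lk]; rewrite !inE -!val_eqE /= !inordK //.
    by move: k lk; do 6 case=> //.
  by rewrite !imsetU !imset_set1.
exists [set f @: (e : {set 'I_6}) | e in edge (Y 5 4)]; split=> /=.
  apply/subsetP => _ /imsetP[e + ->]; rewrite !inE => /orP[] /eqP ->.
    by rewrite E1.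
  by rewrite E2.
exists f; split=> //.
by apply/setP => x; apply/imsetP/imsetP => -[i _ ->]; exists i.
Qed.

Lemma card_copy_Y (H : kgraph 5) (S : {set H} * {set {set H}}) :
  is_copy (Y 5 4) S -> #|S.1| = 6.
Proof.
case=> _ [f [finj -> _]].
by rewrite card_imset // -[RHS](card_ord 6); apply: eq_card.
Qed.

(** Vertex sets suffice: with one edge set chosen for each of them, different components have
    different vertex sets. *)
Lemma almost_tiling_of_family (R : realType) (H : kgraph 5) (F : {set {set H}}) (eps : R) :
  trivIset F -> (forall A, A \in F -> exists E, is_copy (Y 5 4) (A, E)) ->
  ((#|~: cover F|)%:R <= eps * (#|H|)%:R)%R -> has_almost_tiling (Y 5 4) H eps.
Proof.
move=> tF copyF leF.
have [E copyE] : exists E : {set H} -> {set {set H}},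
    forall A, A \in F -> is_copy (Y 5 4) (A, E A).
  have /choice[E HE] : forall A, exists E, A \in F -> is_copy (Y 5 4) (A, E).
    by move=> A; have [/copyF[E]|] := boolP (A \in F); [exists E | exists set0].
  by exists E.
exists [set (A, E A) | A in F]; split.
  split=> [_ /imsetP[A AF ->]|_ _ /imsetP[A AF ->] /imsetP[A' A'F ->]].
    exact: copyE.
  move=> AA'; apply: (trivIsetP tF) => //.
  by apply: contraNneq AA' => /= ->.
rewrite (_ : covered _ = cover F) //.
apply/setP => x; apply/bigcupP/bigcupP => [[_ /imsetP[A AF ->] xA]|[A AF xA]].
  by exists A.
by exists (A, E A); rewrite ?imset_f.
Qed.

Lemma set5_swap12 (T : finType) (a b c d e : T) : [set a; b; c; d; e] = [set b; a; c; d; e].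
Proof. by rewrite (setUC [set a] [set b]). Qed.

Lemma set5_swap23 (T : finType) (a b c d e : T) : [set a; b; c; d; e] = [set a; c; b; d; e].
Proof. by rewrite (setUAC [set a] [set b]). Qed.

Lemma min_degree_le_degree (k d : nat) (H : kgraph k) (S : {set H}) :
  #|S| = d -> min_degree d H <= degree S.
Proof.
move=> cS; rewrite /min_degree; have := mem_index_enum S.
elim: (index_enum _) => // A r IH; rewrite inE big_cons => /predU1P[<-|/IH le_r].
  by rewrite cS eqxx geq_minl.
by case: ifP => // _; rewrite geq_min le_r orbT.
Qed.

(** The 3-sets completing the pair to an edge are split: those inside the image of [b] have six
    orderings in the sum, the others are bounded by [card_3sets_meeting]. *)
Lemma link_count (H : kgraph 5) (Z : finType) (b : Z -> H) (u v : H) :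
  injective b -> u != v ->
  6 * degree [set u; v] <= \sum_x \sum_y \sum_z ([set b x; b y; b z; u; v] \in edge H) +
    6 * (#|~: (b @: setT)| * #|H| ^ 2).
Proof.
move=> binj uv; set W := b @: setT.
pose T := [set A : {set H} | (#|A| == 3) && ([set u; v] :|: A \in edge H)].
have -> : degree [set u; v] = #|T| by rewrite /degree cards2 uv.
rewrite (_ : #|T| = #|T :&: [set A : {set H} | A \subset W]| +
    #|T :\: [set A : {set H} | A \subset W]|).
  rewrite mulnDr leq_add //.
    have := @card_3sets_le _ _ b (T :&: [set A : {set H} | A \subset W]) binj.
    move=> /(_ _)/leq_trans; apply.
      by move=> A; rewrite !inE => /andP[/andP[/eqP]].
    do 3 (apply: leq_sum => ? _); rewrite !inE.
    by rewrite (setUC [set u; v]) setUA; case: (_ \in edge H); rewrite ?andbF ?leq_b1.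
  rewrite leq_mul2l; apply: leq_trans (card_3sets_meeting W).
  apply/subset_leq_card/subsetP => A; rewrite !inE.
  by case/andP => -> /andP[->].
by rewrite cardsID.
Qed.

Lemma injection_into (I T : finType) (A : {set T}) : #|I| <= #|A| ->
  exists f : I -> T, injective f /\ forall i, f i \in A.
Proof.
move=> le; exists (fun i => enum_val (widen_ord le (enum_rank i))); split.
  by move=> i j /enum_val_inj/(congr1 val) /= /ord_inj/enum_rank_inj.
by move=> i; apply: enum_valP.
Qed.

Definition Y_packing (H : kgraph 5) (F : {set {set H}}) :=
  trivIset F /\ forall A, A \in F -> exists E, is_copy (Y 5 4) (A, E).

(** The new copies avoid all blocks outside [Bs], so only the members of [F] in [Bs] are removed,
    fewer than [r]. Members of [D] merely lend their vertices. *)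
Lemma larger_Y_packing (H : kgraph 5) (F D : {set {set H}}) (K r : nat)
    (e : 'I_K * bool -> H) (p : 'I_r -> 'I_K)
    (Bs : {set {A | A \in F :|: D}})
    (f : 'I_r -> 'I_4 -> {A | A \in F :|: D} * 'I_6)
    (b : {A | A \in F :|: D} * 'I_6 -> H) :
  Y_packing F -> trivIset (F :|: D) ->
  injective e -> (forall x, e x \notin cover (F :|: D)) ->
  injective b -> (forall z, b z \in val z.1) ->
  #|Bs| < r -> injective p -> injective (fun ij => f ij.1 ij.2) ->
  (forall i j, (f i j).1 \in Bs) ->
  (forall i,
    [set b (f i (inord 0)); b (f i (inord 1)); b (f i (inord 2));
         e (p i, false); e (p i, true)] \in edge H /\
    [set b (f i (inord 0)); b (f i (inord 1)); b (f i (inord 3));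
         e (p i, false); e (p i, true)] \in edge H) ->
  exists2 F' : {set {set H}}, Y_packing F' & #|F| < #|F'|.
Proof.
move=> [tF copyF] tFD einj eout binj bin Bsr pinj finj fBs fedge.
have bcover z : b z \in cover (F :|: D).
  by apply/bigcupP; exists (val z.1); [exact: valP | exact: bin].
(* The edges of [Y 5 4] are the first and the last five of six vertices: the tile vertices [2] and
   [3] go to the two ends, the shared tile vertices and the pair in between. *)
pose code (k : 'I_6) : 'I_4 + bool := nth (inr true)
  [:: inl (inord 2); inl (inord 0); inl (inord 1); inr false; inr true; inl (inord 3)] k.
have code_inj : injective code.
  move=> k l /eqP; rewrite /code nth_uniq //; first by move=> /eqP/ord_inj.
  rewrite /= !inE /= !(inj_eq (@inl_inj _ _)) -!val_eqE /= !inordK //.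
pose g i (k : 'I_6) := match code k with inl j => b (f i j) | inr c => e (p i, c) end.
have g_inj i i' k k' : g i k = g i' k' -> i = i' /\ k = k'.
  rewrite /g => E; suff [-> ck] : i = i' /\ code k = code k'.
    by split=> //; apply: code_inj.
  move: E; case: (code k) => [j|c]; case: (code k') => [j'|c'].
  - by move=> /binj E; have [-> ->] := finj (i, j) (i', j') E.
  - by move=> E; have := eout (p i', c'); rewrite -E bcover.
  - by move=> E; have := eout (p i, c); rewrite E bcover.
  - by move=> /einj[/pinj -> ->].
pose A i := g i @: setT.
have [A0 A1 A2 A3 A4] : [/\ code (inord 0) = inl (inord 2),
    code (inord 1) = inl (inord 0), code (inord 2) = inl (inord 1),
    code (inord 3) = inr false & code (inord 4) = inr true].
  by rewrite /code !inordK.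
have A5 : code (inord 5) = inl (inord 3) by rewrite /code inordK.
have copyA i : exists E, is_copy (Y 5 4) (A i, E).
  have [e1 e2] := fedge i.
  apply: copy_of_Y; first by move=> k k1 /g_inj[].
    rewrite /g A0 A1 A2 A3 A4 set5_swap12 set5_swap23; exact: e1.
  rewrite /g A1 A2 A3 A4 A5.
  by rewrite setUAC [X in X :|: _]setUAC; case: (fedge i).
have AA i i' : i != i' -> [disjoint A i & A i'].
  move=> ii'; rewrite -setI_eq0; apply/eqP/setP => x; rewrite !inE.
  apply/negP => /andP[/imsetP[k _ ->] /imsetP[k' _ /g_inj[E _]]].
  by rewrite E eqxx in ii'.
pose Fs := F :\: val @: Bs.
have AF i C : C \in Fs -> [disjoint A i & C].
  rewrite inE => /andP[CB CF]; rewrite -setI_eq0; apply/eqP/setP => x; rewrite !inE.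
  apply/negP => /andP[/imsetP[k _ ->]]; rewrite /g.
  have CFD : C \in F :|: D by rewrite inE CF.
  case: (code k) => [j|c] xC; last first.
    by case/negP: (eout (p i, c)); apply/bigcupP; exists C.
  case/negP: CB; apply/imsetP; exists (f i j).1 => //.
  apply: contraTeq xC => nC.
  have /trivIsetP/(_ _ _ (valP (f i j).1) CFD) := tFD.
  rewrite eq_sym => /(_ nC) dis.
  by rewrite (disjointFr dis (bin _)).
have Ag i : g i ord0 \in A i by rewrite imset_f.
have A_inj : injective A.
  move=> i i' E; apply/eqP/negPn/negP => /AA; rewrite E -setI_eq0 setIid.
  by move=> /eqP/setP/(_ (g i' ord0)); rewrite Ag inE.
exists (Fs :|: A @: setT).
  split.
    apply/trivIsetP => C C'; rewrite !in_setU.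
    case/orP => [CF|/imsetP[i _ ->]]; case/orP => [C'F|/imsetP[i' _ ->]] nC.
    - move: CF C'F; rewrite !inE => /andP[_ CF] /andP[_ C'F].
      exact: (trivIsetP tF).
    - by rewrite disjoint_sym AF.
    - exact: AF.
    - by apply: AA; apply: contraNneq nC => ->.
  move=> C; rewrite in_setU => /orP[|/imsetP[i _ ->]]; last exact: copyA.
  by rewrite inE => /andP[_]; apply: copyF.
rewrite cardsU (_ : Fs :&: _ = set0).
  rewrite cards0 subn0 card_imset // cardsT card_ord.
  have := cardsID (val @: Bs) F; rewrite -/Fs.
  have := subset_leq_card (subsetIr F (val @: Bs)).
  have := leq_imset_card val Bs.
  move=> le1 le2 <-; rewrite addnC ltn_add2l.
  exact: leq_ltn_trans (leq_trans le2 le1) Bsr.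
apply/setP => C; rewrite !inE; apply/negP => /andP[CFs /imsetP[i _ CA]].
have := AF i C; rewrite inE CFs => /(_ isT); rewrite CA -setI_eq0 setIid.
by move=> /eqP/setP/(_ (g i ord0)); rewrite Ag inE.
Qed.

(** * From minimum degree to an almost perfect tiling *)

Lemma natr_bin3 (R : numDomainType) n :
  (6 * ('C(n, 3))%:R = n%:R * (n%:R - 1) * (n%:R - 2) :> R)%R.
Proof.
have -> : (6 * ('C(n, 3))%:R = (n ^_ 3)%:R :> R)%R.
  by rewrite -natrM mulnC -bin_ffact.
case: n => [|[|[|n]]]; rewrite ?mul0r ?subrr ?mulr0 ?mul0r //.
by rewrite !ffactnS ffactn0 muln1 mulnA !natrM /= -!natr1; ring.
Qed.

(** In the application [x] is the number of blocks and [m] bounds the number of vertices outside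
    them; [216 = 6 ^ 3] passes from vertices to blocks. Half of [eta] is spent on the lower order
    terms of the binomial coefficient and on the triples not inside the blocks. *)
Lemma link_arith (R : realFieldType) (c eta th m N x C d S w : R) :
  (0 <= c -> 0 < eta -> 0 <= N -> 0 <= x -> 91 + th <= 216 * (c + eta / 2) ->
  x * 6 <= N -> 6 * C = N * (N - 1) * (N - 2) ->
  3 * (c + eta) + 6 * m <= eta / 2 * N ->
  (c + eta) * C <= d -> 6 * d <= S + w -> w <= 6 * (m * N ^+ 2) ->
  (91 + th) * x ^+ 3 <= S)%R.
Proof.
move=> c0 eta0 N0 x0 th216 xN bin3 mN Cd dS wN.
have x3 : ((x * 6) ^+ 3 <= N ^+ 3)%R by rewrite lerXn2r ?nnegrE ?mulr_ge0.
have h1 : ((91 + th) * x ^+ 3 <= 216 * (c + eta / 2) * x ^+ 3)%R.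
  by rewrite ler_wpM2r ?exprn_ge0.
have ce : (0 <= c + eta / 2)%R by rewrite addr_ge0 ?divr_ge0 ?(ltW eta0).
have h2 := ler_wpM2l ce x3; rewrite exprMn in h2.
have h3 := ler_wpM2l (sqr_ge0 N) mN.
have h4 : (0 <= (c + eta) * N)%R by rewrite mulr_ge0 // addr_ge0 // ltW.
have h5 : ((c + eta) * (6 * C) = (c + eta) * (N ^+ 3 - 3 * N ^+ 2 + 2 * N))%R.
  by rewrite bin3; ring.
move: h1 h2 h3 h4 h5 Cd dS wN; clear; lra.
Qed.

Lemma block_coordinates (T : finType) (F : {set {set T}}) :
  trivIset F -> (forall A, A \in F -> #|A| = 6) ->
  exists b : {A | A \in F} * 'I_6 -> T,
    [/\ injective b, forall z, b z \in val z.1 & b @: setT = cover F].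
Proof.
move=> tF F6.
pose b (z : {A | A \in F} * 'I_6) :=
  enum_val (cast_ord (esym (F6 (val z.1) (valP z.1))) z.2).
have bin z : b z \in val z.1 by apply: enum_valP.
exists b; split=> // [[A k] [A' k'] E|].
  have AA : A = A'.
    apply: val_inj; apply/eqP/negPn/negP => nA.
    have /trivIsetP/(_ _ _ (valP A) (valP A') nA) dis := tF.
    by have := disjointFr dis (bin (A, k)); rewrite E (bin (A', k')).
  by subst A'; congr pair; move: E => /enum_val_inj/cast_ord_inj.
apply/setP => x; apply/imsetP/bigcupP => [[z _ ->]|[A AF xA]].
  by exists (val z.1); [exact: valP|].
exists (Sub A AF, cast_ord (F6 A AF) (enum_rank_in xA x)) => //.
rewrite /b /= (_ : cast_ord _ _ = enum_rank_in xA x) ?enum_rankK_in //.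
exact: val_inj.
Qed.

Lemma large_degree_almost_tiling (R : realType) (eta eps : R) :
  (0 < eta)%R -> (0 < eps)%R ->
  exists n0 : nat, forall H : kgraph 5, n0 <= #|H| ->
  ((91%:R / 216%:R + eta) * ('C(#|H|, 3))%:R <= (min_degree 2 H)%:R)%R ->
  has_almost_tiling (Y 5 4) H eps.
Proof.
move=> eta0 eps0.
(* The factor [108] is [216 / 2]: only [eta / 2] survives in [link_arith]. *)
pose th : R := Num.min 1%R (108 * eta)%R.
have th0 : (0 < th)%R by rewrite lt_min ltr01 mulr_gt0.
have th1 : (th <= 1)%R by rewrite ge_min lexx.
have theta : (th <= 108 * eta)%R by rewrite ge_min lexx orbT.
have [K [q0 core]] := many_disjoint_tiles th0 th1.
have [n1 n10 n1P] := exists_nat_ge ((K * 2)%N%:R / eps)%R.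
(* Outside the blocks lie only the [K] pairs and at most five further vertices. *)
pose m : R := ((K * 2 + 5)%N%:R)%R.
have [n2 n20 n2P] := exists_nat_ge ((3 * (91 / 216 + eta) + 6 * m) / (eta / 2))%R.
exists (maxn n1 (maxn n2 (6 * q0 + (K * 2 + 5)))) => H.
rewrite !geq_max => /and3P[nn1 nn2 nq] degH.
have [F [packF maxF]] : exists F : {set {set H}}, @Y_packing H F /\
    forall F', @Y_packing H F' -> #|F'| <= #|F|.
  have P0 : `[< @Y_packing H set0 >].
    apply/asboolP; split; last by move=> A; rewrite inE.
    by apply/trivIsetP => A; rewrite inE.
  have [F /asboolP PF maxF] := @arg_maxnP _ set0 (fun F => `[< @Y_packing H F >])
    (fun F : {set {set H}} => #|F|) P0.
  by exists F; split=> // F' /asboolP/maxF.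
have [tF copyF] := packF.
have [leF|ltF] := leP (#|~: cover F|%:R)%R (eps * #|H|%:R)%R.
  exact: almost_tiling_of_family leF.
exfalso.
(* The missed vertices have room for [K] disjoint pairs; the rest of them is cut into the extra
   blocks [D]. *)
have KU : #|{: 'I_K * bool}| <= #|~: cover F|.
  rewrite card_prod card_ord card_bool -(ler_nat R) ltW // (le_lt_trans _ ltF) //.
  by rewrite mulrC -ler_pdivrMr // (le_trans n1P) // ler_nat.
have [e [einj eU]] := injection_into KU.
have cP : #|e @: setT| = K * 2.
  by rewrite card_imset // cardsT card_prod card_ord card_bool.
have [D [tD Dsub cD]] := maximal_6packing (~: cover F :\: e @: setT).
have coverD : cover D \subset ~: cover F :\: e @: setT.
  by apply/bigcupsP => C /Dsub[].
have F6 A : A \in F :|: D -> #|A| = 6.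
  by rewrite inE => /orP[/copyF[E /card_copy_Y]|/Dsub[]].
have FD A C : A \in F -> C \in D -> [disjoint A & C].
  move=> AF CD; rewrite -setI_eq0; apply/eqP/setP => x; rewrite !inE.
  apply/negP => /andP[xA xC].
  have := subsetP (Dsub C CD).2 x xC; rewrite !inE => /andP[_ /negP]; apply.
  by apply/bigcupP; exists A.
have tFD : trivIset (F :|: D).
  apply/trivIsetP => A C; rewrite !inE => /orP[AF|AD] /orP[CF|CD] AC.
  - exact: (trivIsetP tF).
  - exact: FD.
  - by rewrite disjoint_sym FD.
  - exact: (trivIsetP tD).
have eout x : e x \notin cover (F :|: D).
  apply/negP => /bigcupP[C]; rewrite inE => /orP[CF|CD] xC.
    have := eU x; rewrite inE => /negP; apply.
    by apply/bigcupP; exists C.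
  have := subsetP (Dsub C CD).2 _ xC; rewrite !inE => /andP[/negP + _]; apply.
  exact: imset_f.
have [b [binj bin bcover]] := block_coordinates tFD F6.
pose B := {A | A \in F :|: D}.
pose n := #|H|; pose q := #|{: B}|.
have cW : #|~: (b @: setT)| <= K * 2 + 5.
  apply: (@leq_trans #|(e @: setT) :|: ((~: cover F :\: e @: setT) :\: cover D)|).
    apply/subset_leq_card/subsetP => x; rewrite bcover inE => xW.
    have notin (G : {set {set H}}) : G \subset F :|: D -> x \notin cover G.
      move=> sG; apply: contra xW => /bigcupP[C CG xC].
      by apply/bigcupP; exists C => //; apply: (subsetP sG).
    rewrite !in_setU !in_setD !in_setC (negPf (notin F (subsetUl _ _))).
    by rewrite (negPf (notin D (subsetUr _ _))); case: (x \in _).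
  by rewrite (leq_trans (leq_card_setU _ _)) // cP leq_add2l -ltnS.
have cb : #|b @: setT| = q * 6 by rewrite card_imset // cardsT card_prod card_ord.
have nqle : n <= q * 6 + (K * 2 + 5).
  by have := cardsC (b @: setT); rewrite -/n => <-; rewrite cb leq_add2l.
have qn : q * 6 <= n by rewrite -cb max_card.
pose L (p : 'I_K) (x y z : B * 'I_6) :=
  [set b x; b y; b z; e (p, false); e (p, true)] \in edge H.
have [||||r [Bs [p [f [Bsr pinj finj fBs fL]]]]] := core B _ L.
- by have := leq_trans nq nqle; rewrite leq_add2r mulnC leq_pmul2r.
- by move=> p x y z; rewrite /L set5_swap12.
- by move=> p x y z; rewrite /L set5_swap23.
- move=> p; rewrite -/q.
  have uv : e (p, false) != e (p, true) by rewrite (inj_eq einj) xpair_eqE andbF.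
  have := link_count binj uv.
  rewrite -(ler_nat R) natrD; set SL := (\sum_x _)%N => link.
  have deg : ((91 / 216 + eta) * 'C(n, 3)%:R <=
      (degree [set e (p, false); e (p, true)])%:R)%R.
    apply: le_trans degH _; rewrite ler_nat min_degree_le_degree //.
    by rewrite cards2 uv.
  suff : ((91 + th) * q%:R ^+ 3 <= SL%:R :> R)%R by [].
  have cWR : ((6 * (#|~: (b @: setT)| * #|H| ^ 2))%N%:R <= 6 * (m * n%:R ^+ 2) :> R)%R.
    by rewrite -natrX -!natrM ler_nat !leq_mul.
  have bin3 := natr_bin3 R n.
  have qnR : (q%:R * 6 <= n%:R :> R)%R by rewrite -natrM ler_nat.
  have n2R : ((3 * (91 / 216 + eta) + 6 * m) <= eta / 2 * n%:R)%R.
    by rewrite [leRHS]mulrC -ler_pdivrMr ?divr_gt0 // (le_trans n2P) // ler_nat.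
  have th216 : (91 + th <= 216 * (91 / 216 + eta / 2))%R by clear -theta; lra.
  have c0 : (0 <= 91 / 216 :> R)%R by rewrite divr_ge0 ?ler0n.
  rewrite natrM in link.
  exact: link_arith c0 eta0 (ler0n R n) (ler0n R q) th216 qnR bin3 n2R deg link cWR.
have [F' packF' ltFF'] := larger_Y_packing packF tFD einj eout binj bin Bsr pinj finj
  fBs (fun i => andP (fL i)).
by have := maxF F' packF'; rewrite leqNgt ltFF'.
Qed.

(** * The space barrier *)

Section LimSup.
Import classical_sets.

(** The limit superior along [F] is the infimum of the suprema over the members of [F], so one
    member suffices for an upper bound. *)
Lemma limf_esup_le (R : realType) (T : choiceType) (X : filteredType T)
    (f : X -> \bar R) (F : set (set X)) (l : \bar R) (A : set X) :
  F A -> (forall x, A x -> (f x <= l)%E) -> (limf_esup f F <= l)%E.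
Proof.
move=> FA Al; apply: ge_ereal_inf; exists (ereal_sup [set f x | x in A]%classic).
  by exists A.
by apply: ge_ereal_sup => _ [x Ax <-]; apply: Al.
Qed.

Lemma limf_esup_ge (R : realType) (T : choiceType) (X : filteredType T)
    (f : X -> \bar R) (F : set (set X)) (l : \bar R) :
  (forall A, F A -> exists2 x, A x & (l <= f x)%E) -> (l <= limf_esup f F)%E.
Proof.
move=> H; apply: le_ereal_inf_tmp => _ [A FA <-].
have [x Ax lx] := H A FA; apply: le_trans lx _.
by apply: ereal_sup_ubound; exists x.
Qed.

End LimSup.

Section SpaceBarrier.
Variables (n a : nat).

Definition meeting_edges : {set {set 'I_n}} :=
  [set e : {set 'I_n} | (#|e| == 5) && [exists i in e, i < a]].

Lemma card_meeting_edge e : e \in meeting_edges -> #|e| = 5.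
Proof. by rewrite inE => /andP[/eqP]. Qed.

Definition space_barrier : kgraph 5 := KGraph card_meeting_edge.

(** Of the 3-sets disjoint from a pair, those meeting the first [a] vertices complete it to an edge,
    and at most ['C(n - a, 3)] avoid them. *)
Lemma min_degree_space_barrier : a <= n ->
  'C(n - 2, 3) - 'C(n - a, 3) <= min_degree 2 space_barrier.
Proof.
move=> an; rewrite /min_degree; elim/big_rec: _ => [|S m /eqP cS le_m].
  (* The default value ['C(n, 3)] of the minimum has to respect the bound as well. *)
  rewrite (leq_trans (leq_subr _ _)) // card_ord.
  by apply: leq_bin2l; apply: leq_subr.
rewrite leq_min le_m andbT /degree cS.
pose A := [set i : 'I_n | i < a].
have cA : #|A| = a by apply: card_ord_lt.
pose D1 := [set T : {set 'I_n} | T \subset ~: (S : {set 'I_n}) & #|T| == 3].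
pose D2 := [set T : {set 'I_n} | T \subset ~: A & #|T| == 3].
have c1 : #|D1| = 'C(n - 2, 3) by rewrite cards_draws cardsCs setCK card_ord cS.
have c2 : #|D2| = 'C(n - a, 3) by rewrite cards_draws cardsCs setCK card_ord cA.
rewrite -c1 -c2 leq_subLR (leq_trans (subset_leq_card (_ : D1 \subset D2 :|: D1 :\: D2))) //.
  by apply/subsetP => T TD1; rewrite in_setU in_setD TD1 andbT orbN.
apply: (leq_trans (leq_card_setU _ _)); rewrite leq_add2l.
apply/subset_leq_card/subsetP => T; rewrite !inE => /andP[+ /andP[TS cT]].
rewrite cT andbT => /subsetPn[i iT]; rewrite !inE negbK => ia /=.
apply/andP; split.
  rewrite cardsU (_ : S :&: T = set0) ?cards0 ?cS ?(eqP cT) //.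
  by apply/eqP; rewrite setI_eq0 disjoint_sym disjoints_subset.
by apply/existsP; exists i; rewrite inE iT orbT ia.
Qed.

(** Every copy contains an edge and thus one of the first [a] vertices. Disjoint copies have
    different ones, so there are at most [a] copies, of six vertices each. *)
Lemma card_covered_space_barrier (P : {set {set space_barrier} * {set {set space_barrier}}}) :
  a <= n -> is_tiling (Y 5 4) P -> #|covered P| <= 6 * a.
Proof.
move=> an [copyP disP].
pose A := [set i : 'I_n | i < a].
have meet S : S \in P -> exists2 i : 'I_n, i \in S.1 & i \in A.
  move=> SP; have [sub [f [finj S1 S2]]] := copyP S SP.
  have eS : f @: (Y_edge1 5 4) \in S.2 by rewrite S2; apply: imset_f; apply: set21.
  have := subsetP sub _ eS; rewrite inE => /andP[_ /existsP[i /andP[/imsetP[k _ ik] ia]]].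
  by exists i; rewrite ?inE // S1 ik imset_f.
pose F (S : {set space_barrier} * {set {set space_barrier}}) : {set 'I_n} := S.1.
have cP : #|P| <= a.
  pose h S : option 'I_n := [pick i in F S :&: A].
  have hP S : S \in P -> exists i, [/\ h S = Some i, i \in F S & i \in A].
    move=> /meet[i iS iA]; rewrite /h; case: pickP => [j|/(_ i)].
      by rewrite inE => /andP[jS jA]; exists j.
    by rewrite inE iA /F iS.
  have hinj : {in P &, injective h}.
    move=> S S' SP S'P E; apply/eqP/negPn/negP => /(disP S S' SP S'P) dis.
    have [i [hi iS _]] := hP S SP; have [j [hj jS' _]] := hP S' S'P.
    move: E; rewrite hi hj => -[ij]; move: (disjointFr dis iS).
    by rewrite ij => /negP; apply.
  rewrite -(card_in_imset hinj).
  have cA : #|A| = a by apply: card_ord_lt.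
  rewrite -cA -(card_imset (mem A) (Some_inj : injective (@Some 'I_n))).
  apply/subset_leq_card/subsetP => _ /imsetP[S SP ->].
  by have [i [-> _ iA]] := hP S SP; apply: imset_f.
rewrite (leq_trans (leq_card_bigcup _ _)) // mulnC.
rewrite (eq_bigr (fun=> 6)) => [|S SP]; last exact: card_copy_Y (copyP S SP).
by rewrite sum_nat_const leq_mul2r cP.
Qed.

End SpaceBarrier.

(** * Bounds for the threshold and its limit *)

Lemma t_fin_lower (R : realType) (n a : nat) (eps : R) : a <= n ->
  ((6 * a)%N%:R + eps * n%:R < n%:R)%R ->
  'C(n - 2, 3) - 'C(n - a, 3) <= t_fin 5 2 2 n eps.
Proof.
move=> an small; rewrite /t_fin; case: ex_minnP => t /asboolP tt _.
(* A threshold below the minimum degree of the space barrier would provide a tiling that covers more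
   than [6 * a] vertices. *)
rewrite leqNgt; apply/negP => lt.
have cH : #|space_barrier n a| = n by apply: card_ord.
have [|P [tP cov]] := tt (space_barrier n a) cH.
  exact: leq_trans (ltnW lt) (min_degree_space_barrier an).
move: cov; rewrite cH => cov.
have := card_covered_space_barrier an tP; rewrite -(ler_nat R) => le6.
have := cardsC (covered P); rewrite cH => /(congr1 (fun k => k%:R : R)%R).
by rewrite natrD /=; move: cov le6 small; lra.
Qed.

Lemma t_fin_upper (R : realType) (eta eps : R) : (0 < eta)%R -> (0 < eps)%R ->
  exists n0 : nat, forall n, n0 <= n ->
    ((t_fin 5 2 2 n eps)%:R / ('C(n, 3))%:R <= 91 / 216 + eta)%R.
Proof.
move=> eta0 eps0.
have eta2 : (0 < eta / 2)%R by rewrite divr_gt0.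
have [n1 n1P] := large_degree_almost_tiling eta2 eps0.
have [n2 _ n2P] := exists_nat_ge (2 / eta)%R.
exists (maxn n1 (n2 + 3)) => n; rewrite geq_max => /andP[nn1 nn2].
pose C : R := ('C(n, 3))%:R%R.
have C0 : (0 < C)%R by rewrite ltr0n bin_gt0; lia.
have Cn2 : (n2%:R <= C)%R.
  rewrite ler_nat; have [m nm] : exists m, n = m.+3 by exists (n - 3); lia.
  have := bin_ffact n 3; rewrite (_ : 3`! = 6) // !ffactnS ffactn0 nm /=.
  by move: nn2; rewrite nm addn3 !ltnS; nia.
(* Rounding up to a natural number costs at most [1], which the other half of [eta] pays for. *)
pose t := (Num.truncn ((91 / 216 + eta / 2) * C)%R).+1.
have tC : ((91 / 216 + eta / 2) * C < t%:R)%R by apply: truncnS_gt.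
have Ct : (t%:R <= (91 / 216 + eta / 2) * C + 1)%R.
  by rewrite /t -natr1 lerD2r truncn_le mulr_ge0 ?addr_ge0 ?divr_ge0 ?ler0n ?(ltW eta0).
have le_t : t_fin 5 2 2 n eps <= t.
  rewrite /t_fin; case: ex_minnP => s _; apply; apply/asboolP => H cH degH.
  apply: n1P; rewrite cH // -/C (le_trans (ltW tC)) //.
  by rewrite ler_nat.
rewrite ler_pdivrMr // (@le_trans _ _ t%:R%R) ?ler_nat // (le_trans Ct) //.
have : (1 <= eta / 2 * C)%R.
  have : (eta / 2 * (2 / eta) <= eta / 2 * C)%R.
    by rewrite ler_pM2l // (le_trans n2P).
  have -> : (eta / 2 * (2 / eta) = 1)%R by field; rewrite gt_eqF.
  by [].
lra.
Qed.

(** About [5 / 6 * n] vertices lie outside the barrier set, and [1 - (5 / 6) ^ 3 = 91 / 216]. One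
    half of [dl] covers the error in [eps], the other the lower order terms in [n]. *)
Lemma t_fin_ratio_lower (R : realType) (dl eps : R) : (0 < dl)%R -> (0 < eps)%R ->
  (eps <= 1 / 6)%R -> (24 * eps <= dl)%R ->
  exists n0 : nat, forall n, n0 <= n ->
    (91 / 216 - dl <= (t_fin 5 2 2 n eps)%:R / ('C(n, 3))%:R)%R.
Proof.
move=> dl0 eps0 eps1 epsdl.
have [n1 _ n1P] := exists_nat_ge (1 / eps)%R.
have [n2 _ n2P] := exists_nat_ge ((9 + 3 * dl) / (dl / 2))%R.
exists (maxn 4 (maxn n1 n2)) => n; rewrite !geq_max => /and3P[n4 nn1 nn2].
pose N : R := (n%:R)%R.
have N4 : (4 <= N)%R by rewrite ler_nat.
have N0 : (0 < N)%R by lra.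
have x0 : (0 <= N * (1 / 6 - eps))%R by rewrite mulr_ge0 ?subr_ge0 // ltW.
(* The margin gives [6 * a + eps * n < n], while [n - a] is at most [(5 / 6 + 2 * eps) * n] once
   [eps * n >= 1]. *)
pose a := Num.truncn (N * (1 / 6 - eps))%R.
have a1 : (a%:R <= N * (1 / 6 - eps))%R by rewrite truncn_le.
have a2 : (N * (1 / 6 - eps) < a%:R + 1)%R by rewrite natr1 truncnS_gt.
have Neps : (0 < N * eps)%R by rewrite mulr_gt0.
have an : a <= n by rewrite -(ler_nat R) -/N (le_trans a1) //; lra.
have small : ((6 * a)%N%:R + eps * n%:R < n%:R)%R.
  by rewrite natrM -/N; move: a1 Neps; lra.
have := t_fin_lower an small; rewrite leq_subLR -(ler_nat R) natrD.
set t : R := (t_fin _ _ _ _ _)%:R%R => low.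
have C0 : (0 < ('C(n, 3))%:R :> R)%R by rewrite ltr0n bin_gt0 ltnW.
rewrite ler_pdivlMr //.
have b1 := natr_bin3 R n; have b2 := natr_bin3 R (n - 2); have b3 := natr_bin3 R (n - a).
rewrite natrB -/N in b2; last by rewrite (leq_trans _ n4).
rewrite natrB // -/N in b3; rewrite -/N in b1.
set M : R := (N - a%:R)%R in b3.
have N1eps : (1 <= N * eps)%R.
  rewrite -ler_pdivrMr // (le_trans n1P) // ler_nat //.
have M0 : (0 <= M)%R by rewrite subr_ge0 ler_nat.
have M1 : (M <= (5 / 6 + 2 * eps) * N)%R by rewrite /M; move: a2 N1eps; lra.
have M3 : (M * (M - 1) * (M - 2) <= (125 / 216 + 12 * eps) * N ^+ 3)%R.
  have M3 : (M ^+ 3 <= ((5 / 6 + 2 * eps) * N) ^+ 3)%R.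
    by rewrite lerXn2r ?nnegrE // (le_trans M0).
  have e3 : ((5 / 6 + 2 * eps) ^+ 3 <= 125 / 216 + 12 * eps)%R.
    have e2 : (eps ^+ 2 <= eps / 6)%R by rewrite expr2 ler_wpM2l ?(ltW eps0) // -div1r.
    have e3 : (eps ^+ 3 <= eps / 36)%R.
      by rewrite exprS; have := ler_wpM2l (ltW eps0) e2; lra.
    have -> : ((5 / 6 + 2 * eps) ^+ 3 =
      125 / 216 + 25 / 6 * eps + 10 * eps ^+ 2 + 8 * eps ^+ 3)%R by field.
    by move: e2 e3; lra.
  have := ler_wpM2r (exprn_ge0 3 (ltW N0)) e3; rewrite -exprMn => h.
  apply: le_trans (le_trans M3 h).
  have -> : (M * (M - 1) * (M - 2) = M ^+ 3 - M * (3 * M - 2))%R by ring.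
  rewrite lerBlDr lerDl mulr_ge0 //.
  by move: a1 Neps N4; rewrite /M; lra.
have h1 : (9 * N ^+ 2 + 3 * dl * N ^+ 2 <= dl / 2 * N ^+ 3)%R.
  have : (9 + 3 * dl <= dl / 2 * N)%R.
    by rewrite [leRHS]mulrC -ler_pdivrMr ?divr_gt0 // (le_trans n2P) // ler_nat.
  by move=> /(ler_wpM2l (sqr_ge0 N)); lra.
have h2 : (12 * eps * N ^+ 3 <= dl / 2 * N ^+ 3)%R.
  by rewrite ler_wpM2r ?exprn_ge0 ?(ltW N0) //; lra.
have c1 : (6 * ('C(n, 3))%:R = N ^+ 3 - 3 * N ^+ 2 + 2 * N :> R)%R by rewrite b1; ring.
have c2 : (6 * ('C(n - 2, 3))%:R = N ^+ 3 - 9 * N ^+ 2 + 26 * N - 24 :> R)%R.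
  by rewrite b2; ring.
have c3 : (6 * ('C(n - a, 3))%:R <= (125 / 216 + 12 * eps) * N ^+ 3 :> R)%R by rewrite b3.
have c4 : (0 <= dl * N)%R by rewrite mulr_ge0 // ltW.
have N2 : (2 * N <= 3 * N ^+ 2)%R.
  by rewrite expr2 mulrA ler_wpM2r ?(ltW N0) //; clear -N4; lra.
have c5 : (dl * (6 * ('C(n, 3))%:R) = dl * N ^+ 3 - 3 * dl * N ^+ 2 + 2 * (dl * N) :> R)%R.
  by rewrite c1; ring.
move: low c1 c2 c3 c4 c5 h1 h2 N4 N2.
set U : R := ('C(n, 3))%:R%R; set W : R := ('C(n - 2, 3))%:R%R.
set Z : R := ('C(n - a, 3))%:R%R.
lra.
Qed.

Lemma t_lim_5_2_2 (R : realType) : t_lim R 5 2 2 = (91 / 216)%:E.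
Proof.
apply/eqP; rewrite eq_le; apply/andP; split.
  apply/lee_addgt0Pr => eta eta0.
  apply: (limf_esup_le (A := fun eps : R => (0 < eps)%R)).
    exact: (nbhs_right_gt (0 : R)).
  move=> eps eps0; have [n0 H] := t_fin_upper eta0 eps0.
  apply: (limf_esup_le (A := fun n => n0 <= n)); first by exists n0.
  by move=> n nn0; rewrite -EFinD lee_fin H.
apply/lee_subgt0Pr => dl dl0.
apply: limf_esup_ge => A nA.
have d0 : (0 < Num.min (1 / 6) (dl / 24))%R by rewrite lt_min !divr_gt0.
(* Every right neighbourhood of [0] contains some [eps] small enough for [t_fin_ratio_lower]. *)
have : at_right (0 : R) (fun eps => A eps /\ (0 < eps < Num.min (1 / 6) (dl / 24))%R).
  apply: filterS2 nA (filterI (nbhs_right_gt (0 : R)) (nbhs_right_lt d0)).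
  by move=> eps Aeps [h1 h2]; split=> //; rewrite h1 h2.
case/filter_ex => eps [Aeps /andP[eps0]]; rewrite lt_min => /andP[eps1 eps2].
exists eps => //; apply: limf_esup_ge => B [N _ NB].
have [|n0 H] := t_fin_ratio_lower dl0 eps0 (ltW eps1); first by lra.
exists (maxn N n0); first by apply: NB => /=; exact: leq_maxl.
by rewrite -EFinB lee_fin H // leq_maxr.
Qed.

Theorem theoremA1 (R : realType) :
  (forall eta : R, (0 < eta)%R ->
   exists eps0 : R, (0 < eps0)%R /\
   forall eps : R, (0 < eps)%R -> (eps <= eps0)%R ->
   exists n0 : nat, forall n : nat, n0 <= n ->
   forall H : kgraph 5, #|H| = n ->
     ((91%:R / 216%:R + eta) * ('C(n, 3))%:R <= (min_degree 2 H)%:R)%R ->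
     has_almost_tiling (Y 5 4) H eps)
  /\ t_lim R 5 2 2 = (91%:R / 216%:R)%:E.
Proof.
split; last exact: t_lim_5_2_2.
move=> eta eta0; exists 1%R; split=> // eps eps0 _.
have [n0 H] := large_degree_almost_tiling eta0 eps0.
by exists n0 => n nn0 G cG; rewrite -cG => /H; apply; rewrite cG.
Qed.
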